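(* Let $Q:\mathcal{V}_{\mathrm{hex}}\to\mathbb{R}$ be the $(2,2)$-periodic potential whose values on a fundamental cell are $(q_1,\ldots,q_8)=(1,-1,1,2,-2,-1,1,-1)$, where $q_1=Q(\bm{0})$, $q_2=Q(\bm{a}_1)$, $q_3=Q(\bm{b}_+)$, $q_4=Q(\bm{a}_1+\bm{b}_+)$, $q_5=Q(\bm{b}_-)$, $q_6=Q(\bm{a}_1+\bm{b}_-)$, $q_7=Q(\bm{b}_++\bm{b}_-)$, $q_8=Q(\bm{a}_1+\bm{b}_++\bm{b}_-)$, and let $H_\lambda=\Delta_{\mathrm{hex}}+\lambda Q$. Then for $|\lambda|>0$ sufficiently small, $\sigma(H_\lambda)$ consists of four connected components. Moreover, if $\mathfrak{g}_{E,\lambda}$ denotes the gap of $\sigma(H_\lambda)$ that opens at $E$, for $E=0,\pm1$ (the connected component of $\mathbb{R}\setminus\sigma(H_\lambda)$ containing $E$), one has $$\Big(\pm1-\tfrac{\lambda^2}{20},\pm1+\tfrac{\lambda^2}{20}\Big)\subseteq\mathfrak{g}_{\pm1,\lambda}\subseteq\Big(\pm1-\tfrac12\lambda^2,\pm1+\tfrac12\lambda^2\Big)$$ and $$\Big(-\tfrac{|\lambda|}{5},\tfrac{|\lambda|}{5}\Big)\subseteq\mathfrak{g}_{0,\lambda}\subseteq\Big(-\tfrac{|\lambda|}{4},\tfrac{|\lambda|}{4}\Big)$$ for all $|\lambda|>0$ sufficiently small.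
   Context: Hexagonal lattice: let $\bm{a}_1=(1,0)$ and $\bm{b}_\pm=\frac12(3,\pm\sqrt3)$ in $\mathbb{R}^2$, and let $\mathcal{V}_{\mathrm{hex}}=\{n\bm{b}_++m\bm{b}_-:n,m\in\mathbb{Z}\}\cup\{\bm{a}_1+n\bm{b}_++m\bm{b}_-:n,m\in\mathbb{Z}\}$; vertices $u,v$ are neighbors, $u\sim v$, iff their Euclidean distance is $1$ (so each vertex has three neighbors). The Laplacian $\Delta_{\mathrm{hex}}$ is the bounded self-adjoint operator on $\ell^2(\mathcal{V}_{\mathrm{hex}})$ given by $[\Delta_{\mathrm{hex}}\psi]_u=\sum_{v\sim u}\psi_v$ (the adjacency operator). $Q$ acts by multiplication. $Q$ is $(2,2)$-periodic if $Q(u+2\bm{b}_+)=Q(u+2\bm{b}_-)=Q(u)$ for all $u\in\mathcal{V}_{\mathrm{hex}}$. $\sigma$ denotes spectrum. *)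

(* Defs.v *)
From mathcomp Require Import all_boot all_order all_algebra.
From mathcomp Require Import complex.
From mathcomp Require Import all_classical all_reals all_analysis.
Set Implicit Arguments.
Unset Strict Implicit.
Unset Printing Implicit Defensive.
Import Order.TTheory GRing.Theory Num.Theory.
Import numFieldNormedType.Exports.
Local Open Scope classical_set_scope.
Local Open Scope complex_scope.
Local Open Scope ring_scope.

(* The space l^2(V) is represented by the predicate [l2] on functions
   V -> R[i]; operators on l^2(V) are functions (V -> R[i]) -> (V -> R[i]),
   of which only the restriction to [l2] matters. *)
Section SquareSummable.
Variables (R : realType) (V : choiceType).
Implicit Types (f g : V -> R[i]) (S T : (V -> R[i]) -> (V -> R[i])).

Definition sqsum f : \bar R :=
  \esum_(v in [set: V]) (ComplexField.Normc.normc (f v) ^+ 2)%:E.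

Definition l2 : set (V -> R[i]) := [set f | (sqsum f < +oo)%E].

Definition l2norm f : R := Num.sqrt (fine (sqsum f)).

Definition bounded_operator S : Prop :=
  [/\ (forall f, l2 f -> l2 (S f)),
      (forall (a : R[i]) f g, l2 f -> l2 g ->
         S (fun v => a * f v + g v) = (fun v => a * S f v + S g v)) &
      exists M : R, forall f, l2 f -> l2norm (S f) <= M * l2norm f].

Definition shift_op T (z : R[i]) : (V -> R[i]) -> (V -> R[i]) :=
  fun f v => T f v - z * f v.

Definition resolvent_set T : set R[i] :=
  [set z | exists2 S, bounded_operator S &
     forall f, l2 f -> shift_op T z (S f) = f /\ S (shift_op T z f) = f].

Definition spectrum T : set R[i] := ~` resolvent_set T.

End SquareSummable.

Section Components.
Variable X : topologicalType.

Definition components (A : set X) : set (set X) :=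
  [set connected_component A x | x in A].

End Components.

Section Hexagonal.
Variable R : realType.

Definition euclid_dist (u v : R * R) : R :=
  Num.sqrt ((u.1 - v.1) ^+ 2 + (u.2 - v.2) ^+ 2).

Definition a1 : R * R := (1, 0).
Definition bplus : R * R := (3 / 2, Num.sqrt 3 / 2).
Definition bminus : R * R := (3 / 2, - (Num.sqrt 3 / 2)).

Definition hex_lattice : set (R * R) :=
  [set u | exists n m : int, u = bplus *~ n + bminus *~ m]
  `|` [set u | exists n m : int, u = a1 + bplus *~ n + bminus *~ m].

Definition hex_vertex : choiceType := set_type hex_lattice.

Definition hex_adj (u v : hex_vertex) : Prop := euclid_dist (val u) (val v) = 1.

(* \sum_(v \in A) is the sum over a finite support; here A has three elements. *)
Definition hex_laplacian (psi : hex_vertex -> R[i]) : hex_vertex -> R[i] :=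
  fun u => \sum_(v \in [set v | hex_adj u v]) psi v.

Definition hex_schrodinger (Q : hex_vertex -> R) (psi : hex_vertex -> R[i]) :
    hex_vertex -> R[i] :=
  fun u => hex_laplacian psi u + (Q u)%:C * psi u.

Definition periodic22 (Q : hex_vertex -> R) : Prop :=
  forall u v : hex_vertex,
    val v = val u + bplus *+ 2 \/ val v = val u + bminus *+ 2 -> Q v = Q u.

Definition value_at (Q : hex_vertex -> R) (p : R * R) (q : R) : Prop :=
  forall u : hex_vertex, val u = p -> Q u = q.

(* The cast equips R[i] with the topology of its norm. *)
Definition sigma (Q : hex_vertex -> R) : set (R[i] : numClosedFieldType) :=
  spectrum (hex_schrodinger Q).

(* A gap is taken in the real line; [gap Q E] is empty when E lies in the
   spectrum. *)
Definition gap (Q : hex_vertex -> R) (E : R) : set R :=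
  connected_component (~` [set x : R | sigma Q x%:C]) E.

End Hexagonal.

Arguments a1 {R}.
Arguments bplus {R}.
Arguments bminus {R}.

(* Main.v *)
(* Write vertices as (cell, component) with the 8-vertex cells of the period
   lattice.  Then H - E becomes a nearest-neighbour operator on Z^2 with 8x8
   matrix coefficients, and its spectrum is the set of zeros E of
   det (H(alpha, beta) - E) over the torus of quasimomenta: a uniform lower bound
   for the determinant makes 1 - A^* A / m a contraction (A = H - E; the norm bound
   comes from the discrete Fourier transform on finite tori), so that A is inverted
   by fixed-point iteration, while a zero gives damped Bloch waves that are
   approximate eigenvectors.

   For this potential the determinant depends on E and lambda only through
   e = E^2 and m = lambda^2, and is  - 4 I^2 + 4 S K + P  with
   S = cos alpha + cos beta + cos (alpha - beta),
   I = sin alpha - sin beta - sin (alpha - beta), K = - (e - 1 - m) (e - 1 + 2 m).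
   Since S = 3 - 2 (a + b + c) and I^2 = 16 a b c, where a, b, c are the squared
   sines of the half angles, its extremal values over the torus that decide on the
   spectrum are attained at zero quasimomentum or at the Dirac points.  At zero it is
   d^2 (d^2 - (8 + 3 m) d - 9 m) with d = e - 1 - m, so the gap at e = 1 is exactly
   e = 1 - m/8 + O(m^2) .. 1 + m; at the Dirac points it vanishes near
   e = m/16. *)
Require Import Defs.
From mathcomp Require Import all_boot all_order all_algebra.
From mathcomp Require Import fingroup perm cyclic separable cyclotomic.
From mathcomp Require Import complex ring lra zify.
From mathcomp Require Import all_classical all_reals all_analysis.
Set Implicit Arguments.
Unset Strict Implicit.
Unset Printing Implicit Defensive.
Import Order.TTheory GRing.Theory Num.Theory.
Import numFieldNormedType.Exports.
Local Open Scope classical_set_scope.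
Local Open Scope ring_scope.
Local Open Scope complex_scope.

(** * Squared moduli and the discrete Fourier transform *)

Local Notation Re := complex.Re.
Local Notation Im := complex.Im.

Section SquaredModulus.
Variable R : rcfType.
Implicit Types (x y z : R[i]).

(** No Floquet-Bloch decomposition of l^2 is used. Square summability enters only through energies
    on finite windows, bounded uniformly in the window. An operator of finite range compares a
    window with a slightly larger one, so periodization and Parseval on a finite torus are enough.

    The obstacle in the determinant is that the extremal quasimomentum depends on K. Zero
    quasimomentum gives the maximum for K >= 0 and the minimum for K <= -8, while the Dirac points
    give the minimum for -3/2 <= K <= 0. Each of the three gap regions of e (near 0, near 1, above
    the upper band) falls into exactly one of these regimes when m is small. Other values of K occur
    inside the bands, where a single zero found by the intermediate value theorem is enough.

    There are two bands in e, neither containing 0, and E -> -E doubles them into four components.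
    The windows of the theorem become thresholds on e: m/25 and m/16 near 0, 1 - m/10, 1 - m/2 and 1
    + m near 1. *)

Definition abs2 z : R := Re z ^+ 2 + Im z ^+ 2.

Lemma normc2 z : ComplexField.Normc.normc z ^+ 2 = abs2 z.
Proof. by case: z => a b /=; rewrite sqr_sqrtr // addr_ge0 ?sqr_ge0. Qed.

Lemma abs2C z : (abs2 z)%:C = z * conjc z.
Proof. by case: z => a b; apply/eqP; rewrite eq_complex /abs2 /=; apply/andP; split; apply/eqP; ring. Qed.

Lemma abs2_ge0 z : 0 <= abs2 z.
Proof. by rewrite addr_ge0 ?sqr_ge0. Qed.

Lemma abs2M x y : abs2 (x * y) = abs2 x * abs2 y.
Proof. by case: x y => [a b] [c d]; rewrite /abs2 /=; ring. Qed.

Lemma abs20 : abs2 0 = 0 :> R.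
Proof. by rewrite /abs2 /= expr0n /= addr0. Qed.

Lemma abs21 : abs2 1 = 1 :> R.
Proof. by rewrite /abs2 /= expr0n /= addr0 expr1n. Qed.

Lemma abs2N z : abs2 (- z) = abs2 z.
Proof. by case: z => a b; rewrite /abs2 /= !sqrrN. Qed.

Lemma abs2J z : abs2 (conjc z) = abs2 z.
Proof. by case: z => a b; rewrite /abs2 /= !sqrrN. Qed.

Lemma abs2_real (a : R) : abs2 a%:C = a ^+ 2.
Proof. by rewrite /abs2 /= expr0n /= addr0. Qed.

Lemma abs2_eq0 z : (abs2 z == 0) = (z == 0).
Proof. by case: z => a b; rewrite eq_complex paddr_eq0 ?sqr_ge0 //= !sqrf_eq0. Qed.

Lemma abs2X z n : abs2 (z ^+ n) = abs2 z ^+ n.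
Proof. by elim: n => [|n IH]; rewrite ?expr0 ?abs21 // !exprS abs2M IH. Qed.

(** Cauchy-Schwarz against the constant family 1. The induction step is |m F_0 - S|^2 >= 0, with S
    the sum of the m remaining terms. *)
Lemma abs2_sum n (F : 'I_n -> R[i]) :
  abs2 (\sum_i F i) <= n%:R * \sum_i abs2 (F i).
Proof.
elim: n F => [|n IH] F; first by rewrite !big_ord0 abs20 mul0r.
rewrite !big_ord_recl /=.
have := IH (fun i => F (lift ord0 i)).
have : abs2 (\sum_(i < n) F (lift ord0 i)) >= 0 by exact: abs2_ge0.
case: n IH F => [|n] IH F.
  by rewrite !big_ord0 !addr0 mul1r.
set S := \sum_(i < _) F _; set T := \sum_(i < _) abs2 _.
case: (F ord0) S T => a b [c d] T; rewrite /abs2 /= => h0 h1.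
rewrite -[n.+2%:R]natr1; have n0 : 0 < n.+1%:R :> R by rewrite ltr0Sn.
set m := n.+1%:R in h1 n0 *.
rewrite -(ler_pM2l n0).
have : 0 <= (m * a - c) ^+ 2 + (m * b - d) ^+ 2 by rewrite addr_ge0 ?sqr_ge0.
have : (c ^+ 2 + d ^+ 2) * (m + 1) <= m * T * (m + 1).
  by apply: ler_wpM2r => //; rewrite addr_ge0 ?ltW.
nra.
Qed.

(** Young's inequality with unequal weights: with p close to 1, a contraction stays a contraction
    after a source term is added. *)
Lemma abs2D_le (p q : R) x y : 0 < p -> 0 < q -> p^-1 + q^-1 <= 1 ->
  abs2 (x + y) <= p * abs2 x + q * abs2 y.
Proof.
case: x y => [a b] [c d] p0 q0 pq; rewrite /abs2 /=.
have {}pq : p + q <= p * q.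
  move: pq; rewrite -(ler_pM2l (mulr_gt0 p0 q0)) mulr1 mulrDr.
  by rewrite mulrAC mulfV ?gt_eqF // mul1r mulfK ?gt_eqF // addrC.
have sq2 (u v : R) : (u + v) ^+ 2 <= p * u ^+ 2 + q * v ^+ 2.
  have p1 : 0 < p - 1 by rewrite subr_gt0 -(ltr_pM2r q0) mul1r; lra.
  rewrite -subr_ge0 -(pmulr_rge0 _ p1).
  have -> : (p - 1) * (p * u ^+ 2 + q * v ^+ 2 - (u + v) ^+ 2) =
    ((p - 1) * u - v) ^+ 2 + (p * q - (p + q)) * v ^+ 2 by ring.
  by apply: addr_ge0; [exact: sqr_ge0 | apply: mulr_ge0; [rewrite subr_ge0 | exact: sqr_ge0]].
have := sq2 a c; have := sq2 b d; lra.
Qed.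

Lemma unit_conjE z : abs2 z = 1 -> conjc z = z^-1.
Proof.
move=> h; have z0 : z != 0 by rewrite -abs2_eq0 h oner_eq0.
by apply: (mulfI z0); rewrite -abs2C h mulfV.
Qed.

Lemma unity_abs2 N z : (0 < N)%N -> z ^+ N = 1 -> abs2 z = 1.
Proof.
move=> N0 zN; have : abs2 z ^+ N = 1 by rewrite -abs2X zN abs21.
by move/eqP; rewrite pexpr_eq1 ?abs2_ge0 -?lt0n // => /eqP.
Qed.

End SquaredModulus.

(** X^n - 1 is separable when n is invertible, so it has n distinct roots, and a field with n
    distinct n-th roots of unity contains a primitive one. *)
Lemma prim_root_exists (F : closedFieldType) n :
  n%:R != 0 :> F -> exists z : F, n.-primitive_root z.
Proof.
move=> nF; have n_gt0 : (0 < n)%N by case: n nF => //; rewrite eqxx.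
pose p : {poly F} := 'X^n - 1; have [r Dp] := closed_field_poly_normal p.
move: Dp; rewrite (monicP _) ?monicXnsubC // scale1r => Dp.
have rn1 : all (root p) r by apply/allP=> z; rewrite -root_prod_XsubC -Dp.
have sz_r : (n < (size r).+1)%N.
  by rewrite -(size_prod_XsubC r id) -Dp size_XnsubC.
have [|z] := hasP (has_prim_root n_gt0 rn1 _ sz_r); last by exists z.
by rewrite -separable_prod_XsubC -Dp separable_Xn_sub_1.
Qed.

(** * Sums over symmetric windows and over periods *)

Section Windows.
Variable R : realFieldType.
Implicit Types (F G : int -> R) (n m : nat).

Definition win n F : R := \sum_(j < (2 * n).+1) F (j%:Z - n%:Z).

Lemma winS n F : win n.+1 F = F (- n.+1%:Z) + win n F + F n.+1%:Z.
Proof.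
rewrite /win (_ : (2 * n.+1).+1 = ((2 * n).+1).+2); last by lia.
rewrite big_ord_recl big_ord_recr /= addrA; congr (_ + _ + _).
- by congr F; lia.
- by apply: eq_bigr => i _; congr F; rewrite /= /bump /=; lia.
- by congr F; rewrite /bump /=; lia.
Qed.

Lemma win_le n F G : (forall j, (`|j| <= n)%N -> F j <= G j) -> win n F <= win n G.
Proof. by move=> FG; apply: ler_sum => i _; apply: FG; have := ltn_ord i; lia. Qed.

Lemma eq_win n F G : (forall j, (`|j| <= n)%N -> F j = G j) -> win n F = win n G.
Proof. by move=> FG; apply: eq_bigr => i _; apply: FG; have := ltn_ord i; lia. Qed.

Lemma win_ge0 n F : (forall j, 0 <= F j) -> 0 <= win n F.
Proof. by move=> F0; apply: sumr_ge0. Qed.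

Lemma win_mono n m F : (forall j, 0 <= F j) -> (n <= m)%N -> win n F <= win m F.
Proof.
move=> F0 nm; rewrite -(subnK nm); elim: (m - n)%N => // k IH.
by rewrite addSn winS (le_trans IH) // -addrA addrCA lerDl addr_ge0.
Qed.

Lemma winD n F G : win n (fun j => F j + G j) = win n F + win n G.
Proof. exact: big_split. Qed.

Lemma winZ n c F : win n (fun j => c * F j) = c * win n F.
Proof. by rewrite /win mulr_sumr. Qed.

Lemma win_cst n c : win n (fun=> c) = (2 * n).+1%:R * c.
Proof. by rewrite /win sumr_const card_ord mulr_natl. Qed.

Lemma win_ge n F j : (forall j, 0 <= F j) -> (`|j| <= n)%N -> F j <= win n F.
Proof.
move=> F0 jn; have kn : (`|(j + n%:Z)%R| < (2 * n).+1)%N by lia.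
rewrite /win (bigD1 (Ordinal kn)) //=.
have -> : `|(j + n%:Z)%R|%N%:Z - n%:Z = j by lia.
by rewrite lerDl sumr_ge0.
Qed.

End Windows.

Section PeriodicSums.
Variables (V : zmodType) (N : nat) (F : int -> V).
Hypothesis perF : forall j, F (j + N%:Z) = F j.

Lemma sum_period_succ : \sum_(j < N) F (j%:Z + 1) = \sum_(j < N) F j%:Z.
Proof.
case: N perF => [|n] per; first by rewrite !big_ord0.
rewrite big_ord_recr [RHS]big_ord_recl /= addrC; congr (_ + _).
  by rewrite -(per 0); congr F; lia.
by apply: eq_bigr => i _; congr F; rewrite /bump /=; lia.
Qed.

End PeriodicSums.

Lemma sum_period (V : zmodType) (N : nat) (F : int -> V) (a : int) :
  (forall j, F (j + N%:Z) = F j) ->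
  \sum_(j < N) F (j%:Z + a) = \sum_(j < N) F j%:Z.
Proof.
have nat_case (G : int -> V) (n : nat) : (forall j, G (j + N%:Z) = G j) ->
    \sum_(j < N) G (j%:Z + n%:Z) = \sum_(j < N) G j%:Z.
  move=> per; elim: n => [|n IH]; first by apply: eq_bigr => i _; rewrite addr0.
  rewrite -IH -(@sum_period_succ _ _ (fun j => G (j + n%:Z))).
    by apply: eq_bigr => i _; congr G; lia.
  by move=> j; rewrite -(per (j + n%:Z)); congr G; lia.
case: a => n per; first exact: nat_case.
rewrite -(nat_case (fun j => F (j + Negz n)) n.+1).
  by apply: eq_bigr => i _; congr F; lia.
by move=> j; rewrite -(per (j + _)); congr F; lia.
Qed.

(** * Vector fields on Z^2, window energies and Parseval *)

Section Lattice.
Variables (R : rcfType) (d : nat).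
Local Notation C := R[i].
Local Notation vec := 'cV[C]_d.
Local Notation field := (int -> int -> vec).
Implicit Types (u v : vec) (psi phi : field).

Definition vnorm2 v : R := \sum_i abs2 (v i 0).

Lemma vnorm2_ge0 v : 0 <= vnorm2 v.
Proof. by apply: sumr_ge0 => i _; exact: abs2_ge0. Qed.

Lemma vnorm20 : vnorm2 0 = 0.
Proof. by rewrite /vnorm2 big1 // => i _; rewrite mxE abs20. Qed.

Lemma vnorm2_eq0 v : (vnorm2 v == 0) = (v == 0).
Proof.
apply/eqP/eqP => [/eqP|->]; last exact: vnorm20.
rewrite psumr_eq0 => [/allP h|i _]; last exact: abs2_ge0.
apply/colP => i; rewrite mxE; apply/eqP; rewrite -abs2_eq0.
by apply: (implyP (h i _)); rewrite // mem_index_enum.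
Qed.

Lemma vnorm2Z (a : C) v : vnorm2 (a *: v) = abs2 a * vnorm2 v.
Proof. by rewrite mulr_sumr; apply: eq_bigr => i _; rewrite mxE abs2M. Qed.

Lemma vnorm2N v : vnorm2 (- v) = vnorm2 v.
Proof. by apply: eq_bigr => i _; rewrite mxE abs2N. Qed.

Lemma vnorm2D_le (p q : R) u v : 0 < p -> 0 < q -> p^-1 + q^-1 <= 1 ->
  vnorm2 (u + v) <= p * vnorm2 u + q * vnorm2 v.
Proof.
move=> p0 q0 pq; rewrite /vnorm2 !mulr_sumr -big_split; apply: ler_sum => i _.
by rewrite mxE; exact: abs2D_le.
Qed.

Lemma vnorm2_coord v i : abs2 (v i 0) <= vnorm2 v.
Proof.
by rewrite /vnorm2 (bigD1 i) //= lerDl sumr_ge0 // => j _; exact: abs2_ge0.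
Qed.

Lemma vnorm2_mulmx (A : 'M[C]_d) v :
  vnorm2 (A *m v) <= d%:R * (\sum_i \sum_j abs2 (A i j)) * vnorm2 v.
Proof.
rewrite /vnorm2 -mulrA mulr_suml mulr_sumr; apply: ler_sum => i _.
rewrite mxE (le_trans (abs2_sum _)) // ler_wpM2l //.
rewrite mulr_suml; apply: ler_sum => j _; rewrite abs2M ler_wpM2l ?abs2_ge0 //.
exact: vnorm2_coord.
Qed.

(** Truncated squared l^2 norm. Only bounds uniform in n matter, so infinite sums are avoided until
    the transfer to [sqsum]. *)
Definition energy (n : nat) psi : R :=
  win n (fun j => win n (fun l => vnorm2 (psi j l))).

Lemma energy_ge0 n psi : 0 <= energy n psi.
Proof. by apply: win_ge0 => j; apply: win_ge0 => l; exact: vnorm2_ge0. Qed.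

Lemma energy_le n (F G : field) :
  (forall j l, (`|j| <= n)%N -> (`|l| <= n)%N -> vnorm2 (F j l) <= vnorm2 (G j l)) ->
  energy n F <= energy n G.
Proof. by move=> FG; apply: win_le => j jn; apply: win_le => l ln; exact: FG. Qed.

Lemma eq_energy n (F G : field) :
  (forall j l, (`|j| <= n)%N -> (`|l| <= n)%N -> F j l = G j l) ->
  energy n F = energy n G.
Proof. by move=> FG; apply: eq_win => j jn; apply: eq_win => l ln; rewrite FG. Qed.

Lemma energy_mono n m psi : (n <= m)%N -> energy n psi <= energy m psi.
Proof.
move=> nm; apply: (@le_trans _ _ (win n (fun j => win m (fun l => vnorm2 (psi j l))))).
  by apply: win_le => j _; apply: win_mono => // l; exact: vnorm2_ge0.
by apply: win_mono => // j; apply: win_ge0 => l; exact: vnorm2_ge0.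
Qed.

Lemma energy_ge n psi j l : (`|j| <= n)%N -> (`|l| <= n)%N ->
  vnorm2 (psi j l) <= energy n psi.
Proof.
move=> jn ln.
apply: le_trans (win_ge (F := fun j => win n (fun l => vnorm2 (psi j l))) _ jn).
  by apply: (win_ge (F := fun l => vnorm2 (psi j l))) => // k; exact: vnorm2_ge0.
by move=> k; apply: win_ge0 => k'; exact: vnorm2_ge0.
Qed.

Lemma energyZ n (a : C) psi :
  energy n (fun j l => a *: psi j l) = abs2 a * energy n psi.
Proof.
rewrite /energy -winZ; apply: eq_win => j _; rewrite -winZ; apply: eq_win => l _.
exact: vnorm2Z.
Qed.

Lemma energyD_le (p q : R) n psi phi : 0 < p -> 0 < q -> p^-1 + q^-1 <= 1 ->
  energy n (fun j l => psi j l + phi j l) <= p * energy n psi + q * energy n phi.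
Proof.
move=> p0 q0 pq; rewrite /energy -!winZ -winD; apply: win_le => j _.
rewrite -!winZ -winD; apply: win_le => l _; exact: vnorm2D_le.
Qed.

Definition periodic N psi :=
  forall j l, psi (j + N%:Z) l = psi j l /\ psi j (l + N%:Z) = psi j l.

(** Meant for N-th roots of unity x and y; the negative exponents make a shift of the field by a act
    as multiplication by x^a or y^a. *)
Definition dft N psi (x y : C) : vec :=
  \sum_(j < N) \sum_(l < N) (x ^ (- j%:Z) * y ^ (- l%:Z)) *: psi j%:Z l%:Z.

(** Orthogonality of characters: once the squared modulus is expanded, each off-diagonal sum runs
    over the powers of an N-th root of unity other than 1 and vanishes. *)
Lemma parseval1 N (z : C) (g : 'I_N -> C) : N.-primitive_root z ->
  \sum_(k < N) abs2 (\sum_(j < N) (z ^+ k) ^ (- j%:Z) * g j) =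
  N%:R * \sum_(j < N) abs2 (g j).
Proof.
move=> prim; have N0 := prim_order_gt0 prim.
have zN := prim_expr_order prim.
have z0 : z != 0.
  by apply/eqP => e; move: zN; rewrite e expr0n gtn_eqF //= => /esym/eqP; rewrite oner_eq0.
have unitz k : abs2 (z ^+ k) = 1 by rewrite abs2X (unity_abs2 N0 zN) expr1n.
apply: (@complexI R); rewrite rmorphM !rmorph_sum rmorph_nat /=.
under eq_bigr do rewrite abs2C rmorph_sum /= mulr_suml.
transitivity (\sum_(k < N) \sum_(j < N) \sum_(l < N)
    (z ^+ k) ^ (- j%:Z) * g j * conjc ((z ^+ k) ^ (- l%:Z) * g l)).
  by apply: eq_bigr => k _; apply: eq_bigr => j _; rewrite mulr_sumr.
rewrite exchange_big /=; under eq_bigr do rewrite exchange_big /=.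
rewrite mulr_sumr; apply: eq_bigr => j _.
have term k (l : 'I_N) : (z ^+ k) ^ (- j%:Z) * g j * conjc ((z ^+ k) ^ (- l%:Z) * g l) =
    (z ^ (l%:Z - j%:Z)) ^+ k * (g j * conjc (g l)).
  rewrite rmorphM /= mulrACA; congr (_ * _).
  rewrite -[X in conjc X]exprnN rmorphV ?unitfE ?expf_neq0 //= rmorphXn /= unit_conjE //.
  rewrite exprVn invrK [(z ^+ k) ^+ l]exprnP -expfzDr ?expf_neq0 //.
  by rewrite !exprnP exprz_exp mulrC -exprz_exp addrC.
under eq_bigr do under eq_bigr do rewrite term.
rewrite (bigD1 j) //= [X in _ + X]big1 ?addr0.
  under eq_bigr do rewrite subrr expr0z expr1n mul1r.
  by rewrite sumr_const card_ord abs2C mulr_natl.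
move=> l lj; rewrite -mulr_suml.
set w := z ^ _; have wN : w ^+ N = 1.
  by rewrite exprnP exprz_exp mulrC -exprz_exp -exprnP zN exp1rz.
have w1 : w != 1.
  rewrite /w expfzDr // -exprnN; apply: contra lj => /eqP e.
  have := congr1 (fun t => t * z ^+ j) e; rewrite mul1r mulfVK ?expf_neq0 // => /eqP.
  by rewrite (eq_prim_root_expr prim) !modn_small.
suff -> : \sum_(i < N) w ^+ i = 0 by rewrite mul0r.
by have := subrX1 w N; rewrite wN subrr => /esym/eqP;
  rewrite mulf_eq0 subr_eq0 (negbTE w1) => /eqP.
Qed.

End Lattice.

(** * Finite-range translation-invariant operators and their symbols *)

Section LocalOperators.
Variables (R : rcfType) (d : nat).
Local Notation C := R[i].
Local Notation vec := 'cV[C]_d.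
Local Notation field := (int -> int -> vec).
Implicit Types (psi phi : field) (T : field -> field) (s : C -> C -> 'M[C]_d).

Lemma parseval N (z : C) psi : N.-primitive_root z ->
  \sum_(k < N) \sum_(m < N) vnorm2 (dft N psi (z ^+ k) (z ^+ m)) =
  N%:R * (N%:R * \sum_(j < N) \sum_(l < N) vnorm2 (psi j%:Z l%:Z)).
Proof.
move=> prim; rewrite /vnorm2.
transitivity (\sum_(i < d) \sum_(m < N) \sum_(k < N)
    abs2 (dft N psi (z ^+ k) (z ^+ m) i 0)).
  rewrite exchange_big /=.
  under eq_bigr do rewrite exchange_big /=.
  by rewrite exchange_big.
have -> : \sum_(j < N) \sum_(l < N) \sum_i abs2 (psi j%:Z l%:Z i 0) =
    \sum_(i < d) \sum_(j < N) \sum_(l < N) abs2 (psi j%:Z l%:Z i 0).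
  under eq_bigr do rewrite exchange_big /=.
  by rewrite exchange_big.
rewrite !mulr_sumr; apply: eq_bigr => i _.
pose G (m j : 'I_N) := \sum_(l < N) (z ^+ m) ^ (- l%:Z) * psi j%:Z l%:Z i 0.
transitivity (\sum_(m < N) N%:R * \sum_(j < N) abs2 (G m j)).
  apply: eq_bigr => m _; rewrite -(parseval1 _ prim); apply: eq_bigr => k _.
  congr abs2; rewrite /dft summxE; apply: eq_bigr => j _.
  rewrite summxE mulr_sumr; apply: eq_bigr => l _.
  by rewrite mxE mulrA.
rewrite -mulr_sumr exchange_big /=; congr (_ * _).
by rewrite mulr_sumr; apply: eq_bigr => j _; rewrite -(parseval1 _ prim).
Qed.

Lemma dft_shift1 N psi (a : int) (x y : C) : periodic N psi -> x != 0 -> x ^+ N = 1 ->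
  dft N (fun j l => psi (j + a) l) x y = x ^ a *: dft N psi x y.
Proof.
move=> per x0 xN; rewrite /dft scaler_sumr.
pose F (j : int) := \sum_(l < N) (x ^ (a - j) * y ^ (- l%:Z)) *: psi j l%:Z.
transitivity (\sum_(j < N) F (j%:Z + a)).
  apply: eq_bigr => j _; apply: eq_bigr => l _; congr ((x ^ _ * _) *: _); lia.
rewrite sum_period; last first.
  move=> j; apply: eq_bigr => l _; rewrite (per _ _).1; congr ((_ * _) *: _).
  rewrite (_ : a - j = a - (j + N%:Z) + N%:Z); last by lia.
  by rewrite [RHS]expfzDr // -[x ^ N%:Z]exprnP xN mulr1.
apply: eq_bigr => j _; rewrite scaler_sumr; apply: eq_bigr => l _.
by rewrite /F scalerA mulrA -expfzDr.
Qed.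

Lemma dft_shift2 N psi (a : int) (x y : C) : periodic N psi -> y != 0 -> y ^+ N = 1 ->
  dft N (fun j l => psi j (l + a)) x y = y ^ a *: dft N psi x y.
Proof.
move=> per y0 yN; rewrite /dft scaler_sumr; apply: eq_bigr => j _.
pose F (l : int) := (x ^ (- j%:Z) * y ^ (a - l)) *: psi j%:Z l.
transitivity (\sum_(l < N) F (l%:Z + a)).
  apply: eq_bigr => l _; congr ((_ * y ^ _) *: _); lia.
rewrite sum_period; last first.
  move=> l; rewrite /F (per _ _).2; congr ((_ * _) *: _).
  rewrite (_ : a - l = a - (l + N%:Z) + N%:Z); last by lia.
  by rewrite [RHS]expfzDr // -[y ^ N%:Z]exprnP yN mulr1.
rewrite scaler_sumr; apply: eq_bigr => l _.
by rewrite /F scalerA mulrCA -expfzDr.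
Qed.

Lemma eq_dft N psi phi x y : (forall j l, psi j l = phi j l) ->
  dft N psi x y = dft N phi x y.
Proof. by move=> e; apply: eq_bigr => j _; apply: eq_bigr => l _; rewrite e. Qed.

Lemma dftM N (A : 'M[C]_d) psi x y :
  dft N (fun j l => A *m psi j l) x y = A *m dft N psi x y.
Proof.
rewrite /dft mulmx_sumr; apply: eq_bigr => j _; rewrite mulmx_sumr.
by apply: eq_bigr => l _; rewrite scalemxAr.
Qed.

Lemma dftD N psi phi x y :
  dft N (fun j l => psi j l + phi j l) x y = dft N psi x y + dft N phi x y.
Proof.
rewrite /dft -big_split; apply: eq_bigr => j _; rewrite -big_split.
by apply: eq_bigr => l _; rewrite scalerDr.
Qed.

(* [T] is a translation-invariant operator of range [w] acting on the Fourier
   side as multiplication by the matrix [s x y]. *)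
Record local_op (w : nat) T s : Prop := LocalOp {
  lop_local : forall psi phi j l,
    (forall j' l', (`|(j' - j)%R| <= w)%N -> (`|(l' - l)%R| <= w)%N ->
      psi j' l' = phi j' l') -> T psi j l = T phi j l;
  lop_periodic : forall N psi, periodic N psi -> periodic N (T psi);
  lop_dft : forall N psi x y, (0 < N)%N -> periodic N psi ->
    x ^+ N = 1 -> y ^+ N = 1 -> dft N (T psi) x y = s x y *m dft N psi x y }.

Lemma local_op_comp w1 w2 T1 T2 s1 s2 : local_op w1 T1 s1 -> local_op w2 T2 s2 ->
  local_op (w1 + w2) (fun psi => T1 (T2 psi)) (fun x y => s1 x y *m s2 x y).
Proof.
move=> [loc1 per1 dft1] [loc2 per2 dft2]; split.
- move=> psi phi j l e; apply: loc1 => j1 l1 hj hl; apply: loc2 => j2 l2 hj2 hl2.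
  by apply: e; lia.
- by move=> N psi /per2/per1.
- move=> N psi x y N0 per xN yN.
  by rewrite dft1 ?dft2 ?mulmxA //; exact: per2.
Qed.

Lemma local_op_subZ w T s (t : C) : local_op w T s ->
  local_op w (fun psi j l => psi j l - t *: T psi j l) (fun x y => 1%:M - t *: s x y).
Proof.
move=> [loc per dftT]; split.
- move=> psi phi j l e; congr (_ - _ *: _); last exact: loc.
  by apply: e; lia.
- move=> N psi pp; have pT := per _ _ pp.
  by move=> j l; rewrite !(pp _ _).1 !(pp _ _).2 !(pT _ _).1 !(pT _ _).2.
- move=> N psi x y N0 pp xN yN.
  rewrite (@eq_dft _ _ (fun j l => psi j l + (- t)%:M *m T psi j l)).
    rewrite dftD dftM dftT // mul_scalar_mx mulmxBl mul1mx scaleNr.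
    by rewrite scalemxAl.
  by move=> j l; rewrite mul_scalar_mx scaleNr.
Qed.

Definition stencil (N0 N1 N1' N2 N2' : 'M[C]_d) psi : field := fun j l =>
  N0 *m psi j l + N1 *m psi (j + 1) l + N1' *m psi (j - 1) l
  + N2 *m psi j (l + 1) + N2' *m psi j (l - 1).

Definition symbol (N0 N1 N1' N2 N2' : 'M[C]_d) (x y : C) : 'M[C]_d :=
  N0 + x *: N1 + x^-1 *: N1' + y *: N2 + y^-1 *: N2'.

Lemma local_op_stencil N0 N1 N1' N2 N2' :
  local_op 1 (stencil N0 N1 N1' N2 N2') (symbol N0 N1 N1' N2 N2').
Proof.
split.
- by move=> psi phi j l e; rewrite /stencil !e //; lia.
- move=> N psi per j l.
  have e1 a : psi (j + N%:Z + a) l = psi (j + a) l by rewrite addrAC (per _ _).1.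
  have e2 a : psi j (l + N%:Z + a) = psi j (l + a) by rewrite addrAC (per _ _).2.
  by rewrite /stencil !e1 !e2 !(per _ _).1 !(per _ _).2.
- move=> N psi x y N0' per xN yN.
  have nz (z : C) : z ^+ N = 1 -> z != 0.
    by move=> zN; apply/eqP => e; move: zN; rewrite e expr0n gtn_eqF //= => /esym/eqP; rewrite oner_eq0.
  rewrite /stencil !dftD !dftM.
  rewrite (dft_shift1 1) ?(dft_shift1 (-1)) ?(dft_shift2 1) ?(dft_shift2 (-1)) ?nz //.
  by rewrite /symbol !mulmxDl -!scalemxAr !scalemxAl.
Qed.

(** Representative of j modulo 2m+1 in [-m, m]; composing a field with it periodizes the field and
    keeps its values on the window. *)
Definition recenter (m : nat) (j : int) : int :=
  ((j + m%:Z) %% (2 * m).+1%:Z)%Z - m%:Z.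

Lemma recenter_small m j : (`|j| <= m)%N -> recenter m j = j.
Proof. by move=> jm; rewrite /recenter modz_small; lia. Qed.

Lemma recenter_period m j : recenter m (j + (2 * m).+1%:Z) = recenter m j.
Proof. by rewrite /recenter [j + _ + _]addrAC modzDr. Qed.

Lemma energy_periodic m psi : periodic (2 * m).+1 psi ->
  energy m psi = \sum_(j < (2 * m).+1) \sum_(l < (2 * m).+1) vnorm2 (psi j%:Z l%:Z).
Proof.
move=> per; rewrite /energy /win.
rewrite (sum_period (F := fun j => \sum_(l < _) vnorm2 (psi j (l%:Z - m%:Z)))).
  apply: eq_bigr => j _.
  by rewrite (sum_period (F := fun l => vnorm2 (psi j l))) // => l; rewrite (per _ _).2.
by move=> j; apply: eq_bigr => l _; rewrite (per _ _).1.
Qed.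

(* On a window the field can be replaced by a periodic one, because [T] has
   finite range; the bound on the symbol then applies frequency by frequency. *)
Lemma local_op_energy w T s (r : R) : local_op w T s ->
  (forall x y, abs2 x = 1 -> abs2 y = 1 -> forall v, vnorm2 (s x y *m v) <= r * vnorm2 v) ->
  forall n psi, energy n (T psi) <= r * energy (n + w) psi.
Proof.
move=> [loc perT dftT] sr n psi; set m := (n + w)%N; set N := (2 * m).+1.
pose p j l := psi (recenter m j) (recenter m l).
have pp : periodic N p by move=> j l; rewrite /p !recenter_period.
have -> : energy n (T psi) = energy n (T p).
  apply: eq_energy => j l jn ln; apply: loc => j' l' hj hl.
  by rewrite /p !recenter_small // /m; lia.
have -> : energy m psi = energy m p.
  by apply: eq_energy => j l jn ln; rewrite /p !recenter_small.
(* The smaller window is enlarged to a full period of p, where the energy is a sum over a period and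
   Parseval applies. *)
apply: le_trans (energy_mono (T p) (leq_addr w n)) _.
rewrite !energy_periodic //; last exact: perT.
have N0 : 0 < N%:R :> R by rewrite ltr0n.
have [z prim] : exists z : C, N.-primitive_root z.
  by apply: prim_root_exists; rewrite pnatr_eq0.
have zN := prim_expr_order prim.
rewrite -(ler_pM2l N0) -(ler_pM2l N0) -(parseval _ prim).
rewrite [leRHS](_ : _ = r * (N%:R * (N%:R * \sum_(j < N) \sum_(l < N) vnorm2 (p j%:Z l%:Z)))); last by ring.
rewrite -(parseval _ prim) mulr_sumr; apply: ler_sum => k _.
rewrite mulr_sumr; apply: ler_sum => l _.
have xN i : (z ^+ i) ^+ N = 1 by rewrite exprAC zN expr1n.
by rewrite dftT //; apply: sr; apply: (unity_abs2 (N := N)).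
Qed.

End LocalOperators.

(** * Inverting translation-invariant operators on the square lattice *)

Section GeometricLimits.
Variable R : realType.
Implicit Types (q r k : R).

Lemma geometric_small q (e : R) : 0 <= q < 1 -> 0 < e -> exists n, q ^+ n < e.
Proof.
move=> /andP[q0 q1] e0.
have [->|qn0] := eqVneq q 0; first by exists 1%N; rewrite expr1.
have qp : 0 < q by rewrite lt_def qn0.
have [n hn] : exists n : nat, e^-1 / (q^-1 - 1) < n%:R.
  by exists (Num.truncn (e^-1 / (q^-1 - 1))).+1; exact: truncnS_gt.
(* Bernoulli's inequality for 1/q > 1 gives the growth without logarithms. *)
exists n; have bern m : 1 + m%:R * (q^-1 - 1) <= q^-1 ^+ m.
  elim: m => [|m IH]; first by rewrite mul0r addr0 expr0.
  have h : 1 <= q^-1 by rewrite invf_ge1 // ltW.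
  have m0 : 0 <= m%:R :> R by rewrite ler0n.
  rewrite exprS -natr1; apply: le_trans (ler_wpM2l (le_trans ler01 h) IH).
  rewrite -subr_ge0 [leRHS](_ : _ = m%:R * (q^-1 - 1) ^+ 2); last by ring.
  by rewrite mulr_ge0 ?sqr_ge0.
have h : 0 < q^-1 - 1 by rewrite subr_gt0 invf_gt1.
rewrite ltr_pdivrMr // in hn; have {bern} bern := bern n.
have : e^-1 < q^-1 ^+ n by lra.
by rewrite exprVn ltf_pV2 ?posrE ?exprn_gt0.
Qed.

(** The intervals [u n - e n, u n + e n], with e n the tail of the geometric series, are nested; the
    limit is the supremum of their left ends. *)
Lemma geometric_cvg (u : nat -> R) q k : 0 <= q < 1 -> 0 <= k ->
  (forall n, `|u n.+1 - u n| <= k * q ^+ n) ->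
  exists L, forall n, `|L - u n| <= k * q ^+ n / (1 - q).
Proof.
move=> /andP[q0 q1] k0 h; have q1' : 0 < 1 - q by rewrite subr_gt0.
pose e n := k * q ^+ n / (1 - q).
have e0 n : 0 <= e n by rewrite /e !mulr_ge0 ?exprn_ge0 // invr_ge0 ltW.
have eS n : e n = e n.+1 + k * q ^+ n.
  by rewrite /e exprS; field; rewrite gt_eqF.
pose a n := u n - e n; pose b n := u n + e n.
have aS n : a n <= a n.+1.
  have := h n; rewrite ler_norml /a => /andP[h1 _]; have := eS n; lra.
have bS n : b n.+1 <= b n.
  have := h n; rewrite ler_norml /b => /andP[_ h1]; have := eS n; lra.
have amono n m : (n <= m)%N -> a n <= a m.
  by move=> nm; rewrite -(subnK nm); elim: (m - n)%N => // i IH; exact: le_trans (aS _).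
have bmono n m : (n <= m)%N -> b m <= b n.
  by move=> nm; rewrite -(subnK nm); elim: (m - n)%N => // i IH; exact: le_trans (bS _) _.
have ab n m : a n <= b m.
  apply: le_trans (amono _ _ (leq_maxl n m)) _.
  apply: le_trans _ (bmono _ _ (leq_maxr n m)).
  by rewrite /a /b; have := e0 (maxn n m); lra.
have hs : has_sup (range a) by split; [exists (a 0%N), 0%N | exists (b 0%N) => _ [n _ <-]].
exists (sup (range a)) => n; rewrite ler_norml.
have h1 : a n <= sup (range a) by apply: sup_upper_bound => //; exists n.
have h2 : sup (range a) <= b n by apply: ge_sup; [exact: hs.1 | move=> _ [m _ <-]].
by move: h1 h2; rewrite /a /b /e => h1 h2; apply/andP; split; lra.
Qed.

End GeometricLimits.

Section Contraction.
Variables (R : realType) (d : nat).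
Local Notation C := R[i].
Local Notation vec := 'cV[C]_d.
Local Notation field := (int -> int -> vec).
Implicit Types (psi phi : field).

Definition bounded_energy (K : R) psi := forall n, energy n psi <= K.

Lemma field_limit (u : nat -> field) (q K : R) : 0 <= q < 1 -> 0 <= K ->
  (forall n j l, vnorm2 (u n.+1 j l - u n j l) <= (K * q ^+ n) ^+ 2) ->
  exists L, forall n j l,
    vnorm2 (L j l - u n j l) <= d%:R * (2 * (K / (1 - q)) ^+ 2) * (q ^+ 2) ^+ n.
Proof.
move=> q01 K0 h; have q1' : 0 < 1 - q by move/andP: q01 => []; lra.
have sqle (x : R) n : x ^+ 2 <= (K * q ^+ n) ^+ 2 -> `|x| <= K * q ^+ n.
  have Kq : 0 <= K * q ^+ n by rewrite mulr_ge0 ?exprn_ge0 //; case/andP: q01.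
  by move=> hx; rewrite -ler_sqr ?nnegrE // real_normK ?num_real.
have coord n j l i : abs2 (u n.+1 j l i 0 - u n j l i 0) <= (K * q ^+ n) ^+ 2.
  by have := le_trans (vnorm2_coord _ i) (h n j l); rewrite !mxE.
have ReB (x y : C) : complex.Re (x - y) = complex.Re x - complex.Re y by case: x y => ? ? [].
have ImB (x y : C) : complex.Im (x - y) = complex.Im x - complex.Im y by case: x y => ? ? [].
have cvRe (p : int * int * 'I_d) : exists L, forall n,
    `|L - complex.Re (u n p.1.1 p.1.2 p.2 0)| <= K * q ^+ n / (1 - q).
  apply: geometric_cvg => // n; rewrite -ReB; apply: sqle.
  by apply: le_trans (coord n p.1.1 p.1.2 p.2); rewrite lerDl sqr_ge0.
have cvIm (p : int * int * 'I_d) : exists L, forall n,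
    `|L - complex.Im (u n p.1.1 p.1.2 p.2 0)| <= K * q ^+ n / (1 - q).
  apply: geometric_cvg => // n; rewrite -ImB; apply: sqle.
  by apply: le_trans (coord n p.1.1 p.1.2 p.2); rewrite lerDr sqr_ge0.
have [f hf] := choice cvRe; have [g hg] := choice cvIm.
exists (fun j l => \col_i (f (j, l, i) +i* g (j, l, i))) => n j l.
rewrite /vnorm2; set B := 2 * _ ^+ 2.
rewrite [leRHS](_ : _ = \sum_(i < d) B * (q ^+ 2) ^+ n); last first.
  by rewrite sumr_const card_ord -mulrA mulr_natl.
apply: ler_sum => i _; rewrite !mxE /abs2 ReB ImB /=.
have := hf (j, l, i) n; have := hg (j, l, i) n => /=.
set t := K * q ^+ n / (1 - q) => h1 h2.
have t0 : 0 <= t by apply: le_trans h1.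
have -> : B * (q ^+ 2) ^+ n = t ^+ 2 + t ^+ 2.
  by rewrite /B /t exprAC; field; rewrite gt_eqF.
by apply: lerD; rewrite -real_normK ?num_real // ler_sqr ?nnegrE.
Qed.

Variables (w : nat) (B : field -> field) (rho : R).
Hypothesis rho01 : 0 <= rho < 1.
Hypothesis B_sub : forall psi phi j l,
  B (fun j l => psi j l - phi j l) j l = B psi j l - B phi j l.
Hypothesis B_energy : forall n psi, energy n (B psi) <= rho ^+ 2 * energy (n + w) psi.

Let q := rho ^+ 2.
Let q0 : 0 <= q. Proof. exact: sqr_ge0. Qed.
Let q1 : q < 1. Proof. by rewrite expr_lt1 //; case/andP: rho01. Qed.
(** Weights for [energyD_le]: the inverses of p and p' add up to exactly 1, while p q = 2q/(1+q) is
    still below 1. *)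
Let p := 2 / (1 + q).
Let p' := 2 / (1 - q).
Let p_gt0 : 0 < p. Proof. by rewrite divr_gt0 //; have := q0; lra. Qed.
Let p'_gt0 : 0 < p'. Proof. by rewrite divr_gt0 //; have := q1; lra. Qed.
Let pp' : p^-1 + p'^-1 <= 1. Proof. by rewrite /p /p' !invf_div; lra. Qed.
Let t := p * q.
Let t1 : t < 1.
Proof.
rewrite /t /p mulrAC ltr_pdivrMr ?mul1r; have := q0; have := q1; lra.
Qed.

Definition solution_bound : R := p' / (1 - t).

Lemma solution_bound_ge0 : 0 <= solution_bound.
Proof. by apply: divr_ge0; [exact: ltW | have := t1; lra]. Qed.

Lemma fixpoint_step (K M : R) psi phi :
  bounded_energy M psi -> bounded_energy K phi ->
  bounded_energy (t * M + p' * K) (fun j l => B psi j l + phi j l).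
Proof.
move=> hpsi hphi n; apply: le_trans (energyD_le _ _ _ p_gt0 p'_gt0 pp') _.
apply: lerD; last by rewrite ler_pM2l.
rewrite /t -mulrA ler_pM2l //; apply: le_trans (B_energy _ _) _.
exact: ler_wpM2l.
Qed.

(** B enlarges windows, so the energy on a single window satisfies no closed inequality; the
    supremum s over all windows does, namely s <= t s + p' K. The bound M makes s finite and
    disappears from the result. *)
Lemma fixpoint_bound (K M : R) psi phi :
  (forall j l, psi j l - B psi j l = phi j l) ->
  bounded_energy M psi -> bounded_energy K phi ->
  bounded_energy (solution_bound * K) psi.
Proof.
move=> eqn hM hK; set s := sup (range (fun n => energy n psi)).
have hs : has_sup (range (fun n => energy n psi)).
  by split; [exists (energy 0 psi), 0%N | exists M => _ [n _ <-]].
have bs : bounded_energy s psi by move=> n; apply: sup_upper_bound => //; exists n.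
have : s <= t * s + p' * K.
  apply: ge_sup; first exact: hs.1.
  move=> _ [n _ <-]; rewrite (@eq_energy _ _ n _ (fun j l => B psi j l + phi j l)).
    exact: fixpoint_step.
  by move=> j l _ _; rewrite -eqn addrC subrK.
move=> hst n; apply: le_trans (bs n) _.
rewrite /solution_bound mulrAC ler_pdivlMr; have := t1; lra.
Qed.

Let iterate phi (k : nat) : field :=
  iter k (fun psi j l => B psi j l + phi j l) (fun _ _ => 0).

Let B0 j l : B (fun _ _ => 0) j l = 0.
Proof.
by have := B_sub (fun _ _ => 0) (fun _ _ => 0) j l; rewrite !subrr.
Qed.

(** Picard iteration from zero: successive differences have energy at most q^k K on every window, so
    the iterates converge at each site, at a rate uniform in the site. *)
Lemma fixpoint_exists (K : R) phi : 0 <= K -> bounded_energy K phi ->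
  exists psi, (exists M, bounded_energy M psi) /\
    forall j l, psi j l - B psi j l = phi j l.
Proof.
move=> K0 hK.
have ub k : bounded_energy (solution_bound * K) (iterate phi k).
  elim: k => [|k IH] n.
    rewrite (@eq_energy _ _ n _ (fun j l => 0 *: phi j l)).
      by rewrite energyZ abs20 mul0r mulr_ge0 // solution_bound_ge0.
    by move=> j l _ _; rewrite scale0r.
  apply: le_trans (fixpoint_step IH hK n) _.
  have ht : 0 < 1 - t by have := t1; lra.
  by rewrite /solution_bound le_eqVlt; apply/orP; left; apply/eqP; field; rewrite gt_eqF.
have diff k n : energy n (fun j l => iterate phi k.+1 j l - iterate phi k j l) <= q ^+ k * K.
  elim: k n => [|k IH] n.
    rewrite mul1r; apply: le_trans (hK n); apply: energy_le => j l _ _.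
    by rewrite /= subr0 B0 add0r.
  rewrite exprS -mulrA; apply: le_trans _ (ler_wpM2l q0 (IH (n + w)%N)).
  apply: le_trans (B_energy _ _); apply: energy_le => j l _ _.
  by rewrite B_sub /= opprD addrACA subrr addr0.
have half2 : 2^-1 + 2^-1 <= 1 :> R by lra.
have sK : (Num.sqrt K) ^+ 2 = K by rewrite sqr_sqrtr.
have [|psi hpsi] := @field_limit (iterate phi) rho (Num.sqrt K) rho01 (sqrtr_ge0 _).
  move=> n j l; rewrite exprMn sK -exprM mulnC exprM mulrC.
  apply: le_trans (diff n (maxn `|j| `|l|)).
  by apply: (@energy_ge _ _ _ (fun j l => iterate phi n.+1 j l - iterate phi n j l));
    rewrite ?leq_maxl ?leq_maxr.
move: hpsi; set D := _ * (2 * _) => hpsi.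
have D0 : 0 <= D by apply: mulr_ge0 => //; apply: mulr_ge0 => //; exact: sqr_ge0.
(* The uniform rate at one site, summed over the (2n+1)^2 sites of the window. *)
pose c n : R := (2 * n).+1%:R * ((2 * n).+1%:R * D).
have c0 n : 0 <= c n by apply: mulr_ge0 => //; apply: mulr_ge0.
have near k n : energy n (fun j l => psi j l - iterate phi k j l) <= c n * q ^+ k.
  rewrite [leRHS](_ : _ = win n (fun j : int => win n (fun l : int => D * q ^+ k))).
    by apply: win_le => j _; apply: win_le => l _; exact: hpsi.
  by rewrite !win_cst /c; ring.
exists psi; split.
  (* The window is fixed before k: on it some iterate is within energy 1 of the limit, and all
     iterates obey the same bound. *)
  exists (2 * (solution_bound * K) + 2) => n.
  have [||k hk] := @geometric_small R q ((c n + 1)^-1); first by rewrite q0 q1.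
    by rewrite invr_gt0; have := c0 n; lra.
  rewrite (@eq_energy _ _ n _ (fun j l => iterate phi k j l + (psi j l - iterate phi k j l))).
    apply: le_trans (energyD_le _ _ _ (ltr0Sn _ 1) (ltr0Sn _ 1) half2) _.
    apply: lerD; first by rewrite ler_pM2l //; exact: ub.
    rewrite ler_piMr //; apply: le_trans (near k n) _.
    have cp : 0 < c n + 1 by have := c0 n; lra.
    rewrite -(ler_pM2r cp); rewrite -(ltr_pM2r cp) mulVf ?gt_eqF // in hk.
    have := c0 n; nra.
  by move=> j l _ _; rewrite addrC subrK.
move=> j l; apply/eqP; rewrite -subr_eq0 -vnorm2_eq0 eq_le vnorm2_ge0 andbT.
pose n := maxn `|j| `|l|.
pose A := 2 * D + 2 * (q * c (n + w)%N).
have A0 : 0 <= A by apply: addr_ge0; apply: mulr_ge0 => //; apply: mulr_ge0.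
(* The iteration itself cancels phi, so the residual only involves the distances of psi to two
   successive iterates. *)
have key k : vnorm2 (psi j l - B psi j l - phi j l) <= A * q ^+ k.
  have -> : psi j l - B psi j l - phi j l =
      (psi j l - iterate phi k.+1 j l) +
      - B (fun j l => psi j l - iterate phi k j l) j l.
    by rewrite B_sub /= opprB [B _ _ _ + phi _ _]addrC opprD !addrA subrK addrAC.
  apply: le_trans (vnorm2D_le _ _ (ltr0Sn _ 1) (ltr0Sn _ 1) half2) _.
  rewrite vnorm2N.
  have -> : A * q ^+ k = 2 * (D * q ^+ k) + 2 * (q * (c (n + w)%N * q ^+ k)).
    by rewrite /A; ring.
  apply: lerD; rewrite ler_pM2l //.
    apply: le_trans (hpsi _ _ _) _; apply: ler_wpM2l => //.
    by rewrite -/q exprS; apply: ler_piMl; [exact: exprn_ge0 | exact: ltW].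
  apply: le_trans (@energy_ge _ _ n _ j l _ _) _; rewrite ?leq_maxl ?leq_maxr //.
  apply: le_trans (B_energy _ _) _; apply: ler_wpM2l => //; exact: near.
rewrite leNgt; apply/negP => h0.
have [||k hk] := @geometric_small R q (vnorm2 (psi j l - B psi j l - phi j l) / (A + 1)).
- by rewrite q0 q1.
- by rewrite divr_gt0 //; have := A0; lra.
- have Ap : 0 < A + 1 by have := A0; lra.
  rewrite ltr_pdivlMr // in hk; have := key k; have := exprn_ge0 k q0; lra.
Qed.

End Contraction.

(** * Adjoint matrices and inversion by the normal equation *)

Section Adjoint.
Variable R : rcfType.
Local Notation C := R[i].

Definition adjmx m n (A : 'M[C]_(m, n)) : 'M[C]_(n, m) := map_mx conjc A^T.

Lemma adjmxK m n (A : 'M[C]_(m, n)) : adjmx (adjmx A) = A.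
Proof. by apply/matrixP => i j; rewrite !mxE conjcK. Qed.

Lemma adjmxD m n (A B : 'M[C]_(m, n)) : adjmx (A + B) = adjmx A + adjmx B.
Proof. by apply/matrixP => i j; rewrite !mxE rmorphD. Qed.

Lemma adjmxZ m n (a : C) (A : 'M[C]_(m, n)) : adjmx (a *: A) = conjc a *: adjmx A.
Proof. by apply/matrixP => i j; rewrite !mxE rmorphM. Qed.

Lemma adjmxM m n p (A : 'M[C]_(m, n)) (B : 'M[C]_(n, p)) :
  adjmx (A *m B) = adjmx B *m adjmx A.
Proof.
apply/matrixP => i j; rewrite !mxE rmorph_sum; apply: eq_bigr => k _.
by rewrite !mxE rmorphM mulrC.
Qed.

Lemma adjmx_scalar n (a : C) : adjmx (a%:M : 'M[C]_n) = (conjc a)%:M.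
Proof.
by apply/matrixP => i j; rewrite !mxE eq_sym; case: (_ == _); rewrite ?rmorph0.
Qed.

Variable d : nat.
Implicit Types (u v : 'cV[C]_d).

Lemma vnorm2C v : (vnorm2 v)%:C = (adjmx v *m v) 0 0.
Proof.
by rewrite mxE rmorph_sum; apply: eq_bigr => i _; rewrite !mxE /= abs2C mulrC.
Qed.

Lemma vnorm2_subZ (t : R) u v :
  vnorm2 (v - t%:C *: u) =
  vnorm2 v - 2 * t * complex.Re ((adjmx v *m u) 0 0) + t ^+ 2 * vnorm2 u.
Proof.
rewrite mxE raddf_sum /= /vnorm2 !mulr_sumr -sumrB -big_split.
apply: eq_bigr => i _; rewrite !mxE.
by case: (v i 0) => a b; case: (u i 0) => c e; rewrite /abs2 /=; ring.
Qed.

(* [|v - A^* A v / m|^2 = |v|^2 - 2 |A v|^2 / m + |A^* (A v)|^2 / m^2]. *)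
Lemma gradient_contraction (A : 'M[C]_d) (c m : R) : 0 < m ->
  (forall v, c * vnorm2 v <= vnorm2 (A *m v)) ->
  (forall v, vnorm2 (adjmx A *m v) <= m * vnorm2 v) ->
  forall v, vnorm2 ((1%:M - (m^-1)%:C *: (adjmx A *m A)) *m v) <= (1 - c / m) * vnorm2 v.
Proof.
move=> m0 hc hm v; rewrite mulmxBl mul1mx -scalemxAl -mulmxA vnorm2_subZ.
have -> : adjmx v *m (adjmx A *m (A *m v)) = adjmx (A *m v) *m (A *m v).
  by rewrite adjmxM mulmxA.
rewrite -vnorm2C /=; have := hc v; have := hm (A *m v).
set a := vnorm2 v; set b := vnorm2 (A *m v); set e := vnorm2 _ => h1 h2.
have h3 : m^-1 ^+ 2 * e <= m^-1 * b.
  by rewrite expr2 -mulrA ler_pM2l ?invr_gt0 // mulrC ler_pdivrMr // mulrC.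
have h4 : c / m * a <= m^-1 * b.
  by rewrite mulrAC mulrC ler_pM2l ?invr_gt0.
rewrite mulrBl mul1r mulrAC -mulrA; lra.
Qed.

End Adjoint.

Section FiveSums.
Variables (R : rcfType) (d : nat).
Local Notation C := R[i].

(** d times the squared Frobenius norm, a crude bound for the squared operator norm. *)
Definition mxbound (A : 'M[C]_d) : R := d%:R * (\sum_i \sum_j abs2 (A i j)).

Lemma mxbound_ge0 A : 0 <= mxbound A.
Proof.
apply: mulr_ge0 => //; apply: sumr_ge0 => i _; apply: sumr_ge0 => j _; exact: abs2_ge0.
Qed.

(** Four nested uses of |x + y|^2 <= 2 |x|^2 + 2 |y|^2 cost at most 2^4 on each term, whence the
    16. *)
Lemma vnorm2D5 (a b c e f : 'cV[C]_d) (K t : R) (A B D E F : 'M[C]_d) u :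
  0 <= t -> K = 16 * (mxbound A + mxbound B + mxbound D + mxbound E + mxbound F) ->
  vnorm2 a <= t * vnorm2 (A *m u) -> vnorm2 b <= t * vnorm2 (B *m u) ->
  vnorm2 c <= t * vnorm2 (D *m u) -> vnorm2 e <= t * vnorm2 (E *m u) ->
  vnorm2 f <= t * vnorm2 (F *m u) ->
  vnorm2 (a + b + c + e + f) <= K * t * vnorm2 u.
Proof.
move=> t0 -> ha hb hc he hf.
have half2 : 2^-1 + 2^-1 <= 1 :> R by lra.
have D2 (x y : 'cV[C]_d) : vnorm2 (x + y) <= 2 * vnorm2 x + 2 * vnorm2 y.
  exact: (vnorm2D_le _ _ (ltr0Sn _ 1) (ltr0Sn _ 1) half2).
have mulb (M : 'M[C]_d) x : x <= t * vnorm2 (M *m u) ->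
    x <= t * (mxbound M * vnorm2 u) /\ 0 <= t * (mxbound M * vnorm2 u).
  move=> h; split; last first.
    by apply: mulr_ge0 => //; apply: mulr_ge0; [exact: mxbound_ge0 | exact: vnorm2_ge0].
  by apply: le_trans h _; apply: ler_wpM2l => //; exact: vnorm2_mulmx.
have [/[swap] ? ?] := mulb _ _ ha; have [/[swap] ? ?] := mulb _ _ hb.
have [/[swap] ? ?] := mulb _ _ hc; have [/[swap] ? ?] := mulb _ _ he.
have [/[swap] ? ?] := mulb _ _ hf.
have := D2 (a + b + c + e) f; have := D2 (a + b + c) e; have := D2 (a + b) c.
have := D2 a b; lra.
Qed.

End FiveSums.

Section LatticeResolvent.
Variables (R : realType) (d : nat).
Local Notation C := R[i].
Local Notation field := (int -> int -> 'cV[C]_d).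
Implicit Types (psi phi : field) (v : 'cV[C]_d).
Variables (M0 M1 M2 : 'M[C]_d).
Hypothesis M0_herm : adjmx M0 = M0.

(** The operator minus z; the adjoints as backward hops make it symmetric at z = 0 when M0 is
    Hermitian. *)
Definition lat (z : C) psi : field :=
  stencil (M0 - z%:M) M1 (adjmx M1) M2 (adjmx M2) psi.

Definition lat_symbol (z x y : C) : 'M[C]_d :=
  symbol (M0 - z%:M) M1 (adjmx M1) M2 (adjmx M2) x y.

Lemma lat_linear z (a : C) psi phi j l :
  lat z (fun j l => a *: psi j l + phi j l) j l = a *: lat z psi j l + lat z phi j l.
Proof.
rewrite /lat /stencil !mulmxDr -!scalemxAr !scalerDr.
by do 4 (rewrite [RHS]addrACA; congr (_ + _)).
Qed.

Lemma latE z psi j l : lat z psi j l = lat 0 psi j l - z *: psi j l.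
Proof.
rewrite /lat /stencil !mulmxBl !mul_scalar_mx scale0r subr0 -!addrA; congr (_ + _).
by rewrite addrC -!addrA.
Qed.

Lemma eq_lat z psi phi : (forall j l, psi j l = phi j l) -> lat z psi = lat z phi.
Proof. by move=> e; congr lat; apply: funext => j; apply: funext => l. Qed.

(** Both products expand to the same polynomial in [lat 0]; the identity holds site by site, without
    summability. *)
Lemma latC z w psi j l : lat z (lat w psi) j l = lat w (lat z psi) j l.
Proof.
have expand a b : lat a (lat b psi) j l =
    lat 0 (lat 0 psi) j l - (a + b) *: lat 0 psi j l + (a * b) *: psi j l.
  rewrite latE [lat b psi j l]latE.
  have -> : lat b psi = (fun j l => (- b) *: psi j l + lat 0 psi j l).
    by apply: funext => j'; apply: funext => l'; rewrite latE scaleNr addrC.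
  have -> : lat 0 (fun j l => (- b) *: psi j l + lat 0 psi j l) j l =
      (- b) *: lat 0 psi j l + lat 0 (lat 0 psi) j l by exact: lat_linear.
  rewrite scalerBr scalerA scaleNr scalerDl opprB opprD.
  move: (lat 0 (lat 0 psi) j l) (b *: lat 0 psi j l) (a *: _) => P Q S.
  by rewrite [- Q + P]addrC -!addrA; congr (_ + _); rewrite [LHS]addrA [LHS]addrC.
by rewrite (expand z w) (expand w z) [z + w]addrC [z * w]mulrC.
Qed.

Lemma adjmx_lat_symbol z x y : abs2 x = 1 -> abs2 y = 1 ->
  adjmx (lat_symbol z x y) = lat_symbol (conjc z) x y.
Proof.
move=> hx hy; rewrite /lat_symbol /symbol -!unit_conjE //.
rewrite !adjmxD !adjmxZ !adjmxK !conjcK M0_herm.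
rewrite -[- z%:M]scaleN1r adjmxZ adjmx_scalar rmorphN rmorph1 scaleN1r.
by rewrite -!addrA; congr (_ + (_ + _)); rewrite addrCA; congr (_ + (_ + _)); rewrite addrC.
Qed.

Definition lat_bound (z : C) : R :=
  16 * (mxbound (M0 - z%:M) + mxbound M1 + mxbound (adjmx M1) + mxbound M2 + mxbound (adjmx M2)).

Lemma lat_bound_ge0 z : 0 <= lat_bound z.
Proof.
apply: mulr_ge0 => //.
by do 4 (apply: addr_ge0; last exact: mxbound_ge0); exact: mxbound_ge0.
Qed.

Lemma lat_symbol_bound z x y v : abs2 x = 1 -> abs2 y = 1 ->
  vnorm2 (lat_symbol z x y *m v) <= lat_bound z * vnorm2 v.
Proof.
move=> hx hy; rewrite -[lat_bound z]mulr1 /lat_symbol /lat_bound.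
move: (M0 - z%:M) => A0; rewrite /symbol !mulmxDl -!scalemxAl.
have hV (t : C) : abs2 t = 1 -> abs2 t^-1 = 1 by move=> h; rewrite -unit_conjE // abs2J.
apply: (vnorm2D5 ler01 erefl).
all: by rewrite ?vnorm2Z ?hV ?hx ?hy // ?mul1r.
Qed.

Lemma local_op_lat z : local_op 1 (lat z) (lat_symbol z).
Proof. exact: local_op_stencil. Qed.

Lemma lat_energy z n psi : energy n (lat z psi) <= lat_bound z * energy (n + 1) psi.
Proof.
apply: local_op_energy; first exact: local_op_lat.
by move=> x y hx hy v; exact: lat_symbol_bound.
Qed.

Lemma lat_bounded_energy z K psi : bounded_energy K psi ->
  bounded_energy (lat_bound z * K) (lat z psi).
Proof.
move=> h n; apply: le_trans (lat_energy _ _ _) _.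
by apply: ler_wpM2l (h _); exact: lat_bound_ge0.
Qed.

(* The normal equation [A^* A psi = A^* phi] is solved by the fixed-point
   iteration of [1 - A^* A / m]. *)
Lemma lat_resolvent z (c : R) : 0 < c ->
  (forall x y, abs2 x = 1 -> abs2 y = 1 ->
     forall v, c * vnorm2 v <= vnorm2 (lat_symbol z x y *m v)) ->
  exists2 K0 : R, 0 <= K0 &
    (forall phi K, 0 <= K -> bounded_energy K phi ->
       exists2 psi, bounded_energy (K0 * K) psi & forall j l, lat z psi j l = phi j l) /\
    (forall psi phi K M, (forall j l, lat z psi j l = phi j l) ->
       bounded_energy M psi -> bounded_energy K phi -> bounded_energy (K0 * K) psi).
Proof.
(* Adding c to the bound for the adjoint symbol makes m positive and puts 1 - c/m in [0, 1). *)
move=> c0 hc; pose m := lat_bound (conjc z) + c.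
have m0 : 0 < m by have := lat_bound_ge0 (conjc z); rewrite /m; lra.
have m0' : m != 0 by rewrite gt_eqF.
pose t : C := (m^-1)%:C; have t0 : t != 0.
  by rewrite /t eq_complex /= eqxx andbT invr_eq0.
pose B psi : field := fun j l => psi j l - t *: lat (conjc z) (lat z psi) j l.
pose rho := Num.sqrt (1 - c / m).
have cm : 0 <= 1 - c / m < 1.
  rewrite subr_ge0 ler_pdivrMr // mul1r gtrBl divr_gt0 // andbT.
  by rewrite /m lerDr lat_bound_ge0.
have rho2 : rho ^+ 2 = 1 - c / m by rewrite sqr_sqrtr //; case/andP: cm.
have rho01 : 0 <= rho < 1.
  by rewrite sqrtr_ge0 -[ltRHS]sqrtr1 ltr_sqrt ?ltr01 //; case/andP: cm.
have opB : local_op 2 B (fun x y => 1%:M - t *: (lat_symbol (conjc z) x y *m lat_symbol z x y)).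
  by apply: local_op_subZ; exact: (local_op_comp (local_op_lat _) (local_op_lat _)).
have BE n psi : energy n (B psi) <= rho ^+ 2 * energy (n + 2) psi.
  rewrite rho2; apply: local_op_energy opB _ n psi => x y hx hy.
  rewrite -adjmx_lat_symbol //; apply: gradient_contraction => // v; first exact: hc.
  rewrite adjmx_lat_symbol //; apply: le_trans (lat_symbol_bound _ _ hx hy) _.
  by apply: ler_wpM2r; rewrite ?vnorm2_ge0 // /m lerDl ltW.
have lat_sub w psi phi j l : lat w (fun j l => psi j l - phi j l) j l = lat w psi j l - lat w phi j l.
  rewrite (@eq_lat w _ (fun j l => (-1) *: phi j l + psi j l)).
    by rewrite lat_linear scaleN1r addrC.
  by move=> j' l'; rewrite scaleN1r addrC.
have Bsub psi phi j l : B (fun j l => psi j l - phi j l) j l = B psi j l - B phi j l.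
  rewrite /B (@eq_lat _ (lat z (fun j l => _ - _)) (fun j l => lat z psi j l - lat z phi j l)).
    rewrite lat_sub scalerBr !opprB; move: (t *: _) (t *: _) => P Q.
    by rewrite [LHS]addrACA [RHS]addrACA; congr (_ + _); rewrite addrC.
  by move=> j' l'; rewrite lat_sub.
pose K0 := solution_bound rho * (m^-1 ^+ 2 * lat_bound (conjc z)).
have uniq psi phi K M : (forall j l, lat z psi j l = phi j l) ->
    bounded_energy M psi -> bounded_energy K phi -> bounded_energy (K0 * K) psi.
  move=> e hM hK; rewrite /K0 -mulrA.
  apply: (fixpoint_bound rho01 BE (phi := fun j l => t *: lat (conjc z) phi j l)) hM _.
    by move=> j l; rewrite /B opprB addrC subrK (eq_lat _ e).
  move=> n; rewrite energyZ abs2_real -[leRHS]mulrA; apply: ler_wpM2l; first exact: sqr_ge0.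
  exact: lat_bounded_energy.
exists K0.
  apply: mulr_ge0; first exact: solution_bound_ge0.
  by apply: mulr_ge0; [exact: sqr_ge0 | exact: lat_bound_ge0].
split => // phi K hK0 hK.
(* The fixed point solves A^* A f = phi; as A and A^* commute, A^* f is the wanted preimage, and the
   a priori estimate bounds it. *)
have [||f [[M hM] hf]] := fixpoint_exists rho01 Bsub BE (K := m^-1 ^+ 2 * K) (phi := fun j l => t *: phi j l).
- by apply: mulr_ge0 => //; exact: sqr_ge0.
- by move=> n; rewrite energyZ abs2_real; apply: ler_wpM2l => //; exact: sqr_ge0.
have e j l : lat z (lat (conjc z) f) j l = phi j l.
  rewrite latC; have := hf j l; rewrite /B opprB addrC subrK.
  by move/(scalerI t0).
exists (lat (conjc z) f) => //.
exact: (uniq _ phi K _ e (lat_bounded_energy _ hM) hK).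
Qed.

End LatticeResolvent.

Lemma win_geometric (R : realFieldType) (q : R) n : 0 <= q < 1 ->
  win n (fun j => q ^+ `|j|%N) <= 2 / (1 - q).
Proof.
move=> /andP[q0 q1]; have q1' : 0 < 1 - q by lra.
suff : win n (fun j => q ^+ `|j|%N) <= (2 - 2 * q ^+ n.+1) / (1 - q).
  move/le_trans; apply; rewrite ler_pM2r ?invr_gt0 //.
  by have := exprn_ge0 n.+1 q0; lra.
rewrite ler_pdivlMr //; elim: n => [|n IH].
  by rewrite /win big_ord1 subrr expr0 expr1; lra.
rewrite winS abszN !absz_nat.
move: IH; rewrite [q ^+ n.+2]exprS; lra.
Qed.

Lemma absz_step (j : int) :
  [/\ (`|j| <= `|(j + 1)%R|.+1)%N, (`|(j + 1)%R| <= `|j|.+1)%N,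
      (`|j| <= `|(j - 1)%R|.+1)%N & (`|(j - 1)%R| <= `|j|.+1)%N].
Proof. by split; lia. Qed.

Lemma abs2_exprz (R : rcfType) (x : R[i]) (j : int) : abs2 x = 1 -> abs2 (x ^ j) = 1.
Proof.
move=> h; case: j => n; first by rewrite -exprnP abs2X h expr1n.
have -> : x ^ Negz n = (x ^+ n.+1)^-1 by [].
have hn : abs2 (x ^+ n.+1) = 1 by rewrite abs2X h expr1n.
by rewrite -unit_conjE // abs2J.
Qed.

(** * Approximate eigenvectors from damped Bloch waves *)

Section ApproximateEigenvectors.
Variables (R : realType) (d : nat).
Local Notation C := R[i].
Variables (M0 M1 M2 : 'M[C]_d).

Lemma weight_diff (r : R) (a b : nat) : 0 < r < 1 -> (a <= b.+1)%N -> (b <= a.+1)%N ->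
  (r ^+ b - r ^+ a) ^+ 2 <= ((r^-1 - 1) * r ^+ a) ^+ 2.
Proof.
move=> /andP[r0 r1] ab ba.
have h1 : 1 <= r^-1 by rewrite invf_ge1 // ltW.
have [->|[e|e]] : b = a \/ b = a.+1 \/ a = b.+1 by lia.
- by rewrite subrr expr0n /=; exact: sqr_ge0.
- have -> : r ^+ b - r ^+ a = (r - 1) * r ^+ a by rewrite e exprS; ring.
  rewrite !exprMn; apply: ler_wpM2r; first exact: sqr_ge0.
  rewrite -(sqrrN (r - 1)) opprB ler_sqr ?nnegrE; [|lra|lra].
  have := mulVf (lt0r_neq0 r0); nra.
- have -> : r ^+ b - r ^+ a = (1 - r) * r ^+ b by rewrite e exprS; ring.
  have -> : (r^-1 - 1) * r ^+ a = (1 - r) * r ^+ b; last exact: lexx.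
  by rewrite e exprS; field; rewrite gt_eqF.
Qed.

(* The Bloch wave is damped by [r^(|j| + |l|)] with [r] close to 1: the error is
   then small relatively to the field at every site, not only on average. *)
Lemma approximate_eigenvector (z x y : C) (v : 'cV[C]_d) (e : R) : 0 < e ->
  abs2 x = 1 -> abs2 y = 1 -> v != 0 -> lat_symbol M0 M1 M2 z x y *m v = 0 ->
  exists psi M, [/\ bounded_energy M psi, psi 0 0 != 0 &
    forall n, energy n (lat M0 M1 M2 z psi) <= e * energy n psi].
Proof.
move=> e0 hx hy v0 hv.
pose K := 16 * (mxbound (0 : 'M[C]_d) + mxbound M1 + mxbound (adjmx M1) + mxbound M2 + mxbound (adjmx M2)).
have K0 : 0 <= K.
  by apply: mulr_ge0 => //; do 4 (apply: addr_ge0; last exact: mxbound_ge0); exact: mxbound_ge0.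
(* The error relative to the field will be K del^2; here del <= 1 and del (K + e) = e, hence K del^2
   <= e. *)
pose del := e / (K + e); have Ke : 0 < K + e by lra.
have d0 : 0 < del by rewrite divr_gt0.
have d1 : del <= 1 by rewrite ler_pdivrMr // mul1r lerDr.
have dK : del ^+ 2 * K <= e.
  have h : del * (K + e) = e by rewrite mulfVK // gt_eqF.
  have : del * K <= e by rewrite -h ler_pM2l // lerDl ltW.
  by apply: le_trans; rewrite expr2 -mulrA ler_piMl // mulr_ge0 // ltW.
pose r := (1 + del)^-1.
have r01 : 0 < r < 1 by apply/andP; split; [rewrite invr_gt0 | rewrite invf_lt1]; lra.
have rdel : r^-1 - 1 = del by rewrite invrK addrC addKr.
pose wt (j l : int) : R := r ^+ (`|j| + `|l|)%N.
pose psi (j l : int) : 'cV[C]_d := ((wt j l)%:C * (x ^ j * y ^ l)) *: v.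
have psi_norm j l : vnorm2 (psi j l) = wt j l ^+ 2 * vnorm2 v.
  by rewrite vnorm2Z !abs2M abs2_real !abs2_exprz // !mulr1.
have x0 : x != 0 by rewrite -abs2_eq0 hx oner_eq0.
have y0 : y != 0 by rewrite -abs2_eq0 hy oner_eq0.
have r2 : 0 <= r ^+ 2 < 1.
  case/andP: r01 => ra rb; rewrite sqr_ge0 /= expr_lt1 //; exact: ltW.
exists psi, ((2 / (1 - r ^+ 2)) * ((2 / (1 - r ^+ 2)) * vnorm2 v)); split.
- move=> n; rewrite /energy.
  have B0 : 0 <= 2 / (1 - r ^+ 2) by case/andP: r2 => _ h; apply: divr_ge0 => //; lra.
  have -> : win n (fun j => win n (fun l => vnorm2 (psi j l))) =
      win n (fun j => r ^+ 2 ^+ `|j|%N) * (win n (fun l => r ^+ 2 ^+ `|l|%N) * vnorm2 v).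
    rewrite -[LHS](@eq_win _ _ (fun j => (win n (fun l => r ^+ 2 ^+ `|l|%N) * vnorm2 v) * r ^+ 2 ^+ `|j|%N)).
      by rewrite winZ mulrC.
    move=> j _; rewrite mulrAC mulrC mulrA -winZ mulrC -winZ; apply: eq_win => l _.
    by rewrite psi_norm /wt -exprM mulnC exprM exprD exprMn; ring.
  have W0 : 0 <= win n (fun j => r ^+ 2 ^+ `|j|%N).
    by apply: win_ge0 => j; apply: exprn_ge0; exact: sqr_ge0.
  apply: ler_pM => //; last 2 first.
  + exact: win_geometric.
  + by apply: ler_wpM2r; [exact: vnorm2_ge0 | exact: win_geometric].
  + by apply: mulr_ge0 => //; exact: vnorm2_ge0.
- by rewrite /psi /wt !expr0z !mulr1 expr0 scale1r.
move=> n; rewrite /energy -winZ; apply: win_le => j _; rewrite -winZ; apply: win_le => l _.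
rewrite psi_norm mulrA.
have -> : lat M0 M1 M2 z psi j l = (x ^ j * y ^ l) *:
    (0 + ((wt (j + 1) l - wt j l)%:C * x) *: (M1 *m v)
       + ((wt (j - 1) l - wt j l)%:C * x^-1) *: (adjmx M1 *m v)
       + ((wt j (l + 1) - wt j l)%:C * y) *: (M2 *m v)
       + ((wt j (l - 1) - wt j l)%:C * y^-1) *: (adjmx M2 *m v)).
  (* Subtracting the vanishing symbol applied to v, weighted at the site, cancels the undamped wave
     and leaves differences of neighbouring weights. *)
  have hv0 : ((wt j l)%:C * (x ^ j * y ^ l)) *: (lat_symbol M0 M1 M2 z x y *m v) = 0.
    by rewrite hv scaler0.
  rewrite -[LHS]subr0 -[X in _ - X = _]hv0.
  rewrite /lat /stencil /lat_symbol /psi !expfzDr //= !expr1z !exprN1.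
  move: (M0 - z%:M) (adjmx M1) (adjmx M2) => A0 A1 A2.
  rewrite /symbol !mulmxDl -!scalemxAl -!scalemxAr.
  move: (A0 *m v) (M1 *m v) (A1 *m v) (M2 *m v) (A2 *m v) => a0 b1 b2 b3 b4.
  apply/colP => i; rewrite !mxE !rmorphB /=; ring.
rewrite vnorm2Z abs2M !abs2_exprz // !mul1r.
have wt_diff j' l' : (`|j| + `|l| <= (`|j'| + `|l'|).+1)%N ->
    (`|j'| + `|l'| <= (`|j| + `|l|).+1)%N -> (wt j' l' - wt j l) ^+ 2 <= (del * wt j l) ^+ 2.
  by move=> h1 h2; rewrite -rdel; apply: weight_diff.
have hV (t : C) : abs2 t = 1 -> abs2 t^-1 = 1 by move=> h; rewrite -unit_conjE // abs2J.
apply: (@le_trans _ _ (K * (del * wt j l) ^+ 2 * vnorm2 v)); last first.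
  rewrite exprMn; apply: ler_wpM2r; first exact: vnorm2_ge0.
  by rewrite mulrA; apply: ler_wpM2r; [exact: sqr_ge0 | rewrite mulrC].
apply: (@vnorm2D5 _ _ _ _ _ _ _ K _ 0 M1 (adjmx M1) M2 (adjmx M2)) => //.
- exact: sqr_ge0.
- by rewrite mul0mx vnorm20 mulr0.
all: rewrite vnorm2Z abs2M abs2_real ?hV // ?hx ?hy mulr1.
all: apply: ler_wpM2r; first exact: vnorm2_ge0.
all: apply: wt_diff; try (rewrite -addSn leq_add2r); try (rewrite -addnS leq_add2l).
all: by have [? ? ? ?] := absz_step j; have [? ? ? ?] := absz_step l.
Qed.

End ApproximateEigenvectors.

(** * Transfer from lattice fields to l^2 of the vertex set *)

Section LatticeCoordinates.
Variables (R : realType) (V : choiceType) (d : nat).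
Local Notation C := R[i].
Local Notation field := (int -> int -> 'cV[C]_d).
Variables (site : int -> int -> 'I_d -> V).
Variables (row_of col_of : V -> int) (comp_of : V -> 'I_d).
Hypothesis siteK : forall u, site (row_of u) (col_of u) (comp_of u) = u.
Hypothesis row_ofK : forall j l i, row_of (site j l i) = j.
Hypothesis col_ofK : forall j l i, col_of (site j l i) = l.
Hypothesis comp_ofK : forall j l i, comp_of (site j l i) = i.
Implicit Types (f g : V -> C) (psi : field).

Definition to_field f : field := fun j l => \col_i f (site j l i).
Definition of_field psi : V -> C := fun u => psi (row_of u) (col_of u) (comp_of u) 0.

Lemma of_fieldK psi : to_field (of_field psi) = psi.
Proof.
apply: funext => j; apply: funext => l; apply/colP => i.
by rewrite mxE /of_field row_ofK col_ofK comp_ofK.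
Qed.

Lemma to_field_inj f g : (forall j l, to_field f j l = to_field g j l) -> f = g.
Proof.
move=> h; apply: funext => u; rewrite -(siteK u).
by have /colP/(_ (comp_of u)) := h (row_of u) (col_of u); rewrite !mxE.
Qed.

Let N n := (2 * n).+1.
Let box_site n (p : 'I_(N n) * 'I_(N n) * 'I_d) : V :=
  site (p.1.1%:Z - n%:Z) (p.1.2%:Z - n%:Z) p.2.
Let box n : seq V := map (@box_site n) (enum {: 'I_(N n) * 'I_(N n) * 'I_d}).

Let box_uniq n : uniq (box n).
Proof.
rewrite map_inj_uniq ?enum_uniq // => -[[j l] i] [[j' l'] i'] /= e.
rewrite /box_site /= in e.
have := congr1 row_of e; have := congr1 col_of e; have := congr1 comp_of e.
rewrite !row_ofK !col_ofK !comp_ofK => -> hl hj.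
by congr (_, _, _); apply: val_inj => /=; lia.
Qed.

Let energy_box n f :
  (energy n (to_field f))%:E =
  (\sum_(u \in [set` box n]) (ComplexField.Normc.normc (f u) ^+ 2)%:E)%E.
Proof.
rewrite -fsbig_seq // big_map big_enum /= sumEFin; congr EFin.
transitivity (\sum_(j < N n) \sum_(l < N n) \sum_i
    ComplexField.Normc.normc (f (site (j%:Z - n%:Z) (l%:Z - n%:Z) i)) ^+ 2).
  apply: eq_bigr => j _; apply: eq_bigr => l _; apply: eq_bigr => i _.
  by rewrite mxE normc2.
by rewrite pair_bigA pair_bigA.
Qed.

Let nneg f (u : V) : (0 <= (ComplexField.Normc.normc (f u) ^+ 2)%:E)%E.
Proof. by rewrite lee_fin sqr_ge0. Qed.

Lemma sqsum_ge n f : ((energy n (to_field f))%:E <= sqsum f)%E.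
Proof.
rewrite energy_box; apply: esum_ge; exists [set` box n]; last exact: lexx.
by split; [exact: finite_seq | exact: subsetT].
Qed.

(** Every finite set of vertices lies in some window, so uniform window bounds control the supremum
    over finite sets that defines [esum]. *)
Lemma sqsum_le K f : bounded_energy K (to_field f) -> (sqsum f <= K%:E)%E.
Proof.
move=> hK; apply: ub_ereal_sup => _ [A [finA _] <-].
have /finite_fsetP[X AX] := finA.
pose n := (\max_(u <- finmap.enum_fset X) maxn `|row_of u| `|col_of u|)%N.
apply: (@le_trans _ _ (energy n (to_field f))%:E); last by rewrite lee_fin.
rewrite energy_box; apply: (lee_fsum_nneg_subset finA (finite_seq _)); last by move=> u _; exact: nneg.
move=> u; rewrite AX !inE /= => uX.
have : (maxn `|row_of u| `|col_of u| <= n)%N.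
  exact: (@leq_bigmax_seq _ (finmap.enum_fset X) predT
    (fun u => maxn `|row_of u| `|col_of u|) u uX isT).
rewrite geq_max => /andP[hr hc].
have h1 : (`|(row_of u + n%:Z)%R| < N n)%N by rewrite /N; lia.
have h2 : (`|(col_of u + n%:Z)%R| < N n)%N by rewrite /N; lia.
apply/mapP; exists (Ordinal h1, Ordinal h2, comp_of u); first by rewrite mem_enum.
rewrite /box_site /= -[LHS]siteK; congr site; first by clear -hr; lia.
by clear -hc; lia.
Qed.

Lemma l2P f : l2 f <-> exists K, bounded_energy K (to_field f).
Proof.
split=> [h|[K /sqsum_le h]]; last by rewrite /l2 /=; apply: le_lt_trans h (ltry _).
exists (fine (sqsum f)) => n; rewrite -lee_fin fineK; first exact: sqsum_ge.
rewrite ge0_fin_numE //; apply: le_trans (sqsum_ge 0 f).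
by rewrite lee_fin energy_ge0.
Qed.

Lemma l2_energy f : l2 f -> bounded_energy (fine (sqsum f)) (to_field f).
Proof.
move=> h n; rewrite -lee_fin fineK; first exact: sqsum_ge.
rewrite ge0_fin_numE //; apply: le_trans (sqsum_ge 0 f).
by rewrite lee_fin energy_ge0.
Qed.

Lemma fine_sqsum_le K f : bounded_energy K (to_field f) -> fine (sqsum f) <= K.
Proof.
move=> hK; have h : l2 f by apply/l2P; exists K.
rewrite -lee_fin fineK; first exact: sqsum_le.
rewrite ge0_fin_numE //; apply: le_trans (sqsum_ge 0 f).
by rewrite lee_fin energy_ge0.
Qed.

Lemma fine_sqsum_ge0 f : 0 <= fine (sqsum f).
Proof.
apply: fine_ge0; apply: le_trans (sqsum_ge 0 f).
by rewrite lee_fin energy_ge0.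
Qed.

Lemma l2D (a : C) f g : l2 f -> l2 g -> l2 (fun v => a * f v + g v).
Proof.
move=> /l2P[K hK] /l2P[L hL]; apply/l2P.
exists (2 * (abs2 a * K) + 2 * L) => n.
rewrite (@eq_energy _ _ n _ (fun j l => a *: to_field f j l + to_field g j l)).
  have half2 : 2^-1 + 2^-1 <= 1 :> R by lra.
  apply: le_trans (energyD_le _ _ _ (ltr0Sn _ 1) (ltr0Sn _ 1) half2) _.
  apply: lerD; last by rewrite ler_pM2l //; exact: hL.
  by rewrite ler_pM2l // energyZ; apply: ler_wpM2l; [exact: abs2_ge0 | exact: hK].
by move=> j l _ _; apply/colP => i; rewrite !mxE.
Qed.

Variables (M0 M1 M2 : 'M[C]_d).
Hypothesis M0_herm : adjmx M0 = M0.
Variable T : (V -> C) -> (V -> C).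
Hypothesis T_lat : forall f j l, to_field (T f) j l = lat M0 M1 M2 0 (to_field f) j l.

Lemma shift_lat z f j l :
  to_field (shift_op T z f) j l = lat M0 M1 M2 z (to_field f) j l.
Proof. by rewrite latE -T_lat; apply/colP => i; rewrite !mxE. Qed.

Lemma shift_lin z (a : C) f g :
  shift_op T z (fun v => a * f v + g v) = (fun v => a * shift_op T z f v + shift_op T z g v).
Proof.
apply: to_field_inj => j l; rewrite shift_lat.
rewrite (@eq_lat _ _ _ _ _ z _ (fun j l => a *: to_field f j l + to_field g j l)).
  by rewrite lat_linear -!shift_lat; apply/colP => i; rewrite !mxE.
by move=> j' l'; apply/colP => i; rewrite !mxE.
Qed.

(** The a priori bound yields uniqueness in [l2], and uniqueness makes the chosen preimages
    linear. *)
Lemma in_resolvent z (c : R) : 0 < c ->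
  (forall x y, abs2 x = 1 -> abs2 y = 1 ->
     forall v, c * vnorm2 v <= vnorm2 (lat_symbol M0 M1 M2 z x y *m v)) ->
  resolvent_set T z.
Proof.
move=> c0 hc; have [K0 K00 [solve bound]] := lat_resolvent M0_herm c0 hc.
have boundV f g K : l2 g -> shift_op T z g = f -> bounded_energy K (to_field f) ->
    bounded_energy (K0 * K) (to_field g).
  move=> /l2P[M hM] e hK; apply: (bound _ (to_field f) K M) => //.
  by move=> j l; rewrite -shift_lat e.
have uniq f g : l2 f -> l2 g -> shift_op T z f = shift_op T z g -> f = g.
  move=> hf hg e; pose h v := (-1) * f v + g v.
  have hh : l2 h by exact: l2D.
  have := boundV _ h 0 hh erefl; rewrite mulr0 => b0.
  have {b0} h0 : bounded_energy 0 (to_field h).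
    apply: b0 => n; rewrite (@eq_energy _ _ n _ (fun j l => 0 *: to_field f j l)).
      by rewrite energyZ abs20 mul0r.
    by move=> j l _ _; rewrite shift_lin e; apply/colP => i; rewrite !mxE; ring.
  apply: to_field_inj => j l; apply/esym/eqP; rewrite -subr_eq0 -vnorm2_eq0 eq_le vnorm2_ge0 andbT.
  have -> : to_field g j l - to_field f j l = to_field h j l.
    by apply/colP => i; rewrite !mxE /h; ring.
  apply: le_trans (h0 (maxn `|j| `|l|)).
  by apply: energy_ge; rewrite ?leq_maxl ?leq_maxr.
(* Outside [l2] the value of the inverse is arbitrary; f itself is taken. *)
have ex f : exists g, l2 f -> l2 g /\ shift_op T z g = f.
  have [hf|nf] := pselect (l2 f); last by exists f.
  have [psi hpsi e] := solve _ _ (fine_sqsum_ge0 f) (l2_energy hf).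
  exists (of_field psi) => _; split.
    by apply/l2P; exists (K0 * fine (sqsum f)); rewrite of_fieldK.
  by apply: to_field_inj => j l; rewrite shift_lat -e of_fieldK.
have [S hS] := choice ex.
exists S.
  split.
  - by move=> f /hS[].
  - move=> a f g hf hg; apply: uniq.
    + by have [] := hS _ (l2D a hf hg).
    + by apply: l2D; [have [] := hS _ hf | have [] := hS _ hg].
    rewrite shift_lin (hS _ (l2D a hf hg)).2.
    by rewrite (hS _ hf).2 (hS _ hg).2.
  exists (Num.sqrt K0) => f hf; have [hg e] := hS _ hf.
  rewrite /l2norm -sqrtrM // ler_sqrt.
    apply: fine_sqsum_le; apply: boundV hg e _; exact: l2_energy.
  by apply: mulr_ge0 => //; exact: fine_sqsum_ge0.
move=> f hf; have [hg e] := hS _ hf; split => //.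
have hsf : l2 (shift_op T z f).
  have [K hK] := (l2P f).1 hf; apply/l2P; exists (lat_bound M0 M1 M2 z * K) => n.
  rewrite (@eq_energy _ _ n _ (lat M0 M1 M2 z (to_field f))).
    exact: lat_bounded_energy.
  by move=> j l _ _; exact: shift_lat.
by have [h1 h2] := hS _ hsf; apply: uniq.
Qed.

(** Weyl's criterion: an inverse S of norm at most M would give |f|^2 <= M^2 |(T - z) f|^2 <= M^2 /
    (M^2 + 1) |f|^2 for a nonzero approximate eigenvector f. *)
Lemma in_spectrum z (x y : C) (v : 'cV[C]_d) : abs2 x = 1 -> abs2 y = 1 -> v != 0 ->
  lat_symbol M0 M1 M2 z x y *m v = 0 -> spectrum T z.
Proof.
move=> hx hy v0 hv [S [_ _ [M hM]] hS].
have e0 : 0 < (M ^+ 2 + 1)^-1 by rewrite invr_gt0; have := sqr_ge0 M; lra.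
have [psi [K [hK psi0 hpsi]]] := approximate_eigenvector e0 hx hy v0 hv.
pose f := of_field psi.
have fE : to_field f = psi by exact: of_fieldK.
have hf : l2 f by apply/l2P; exists K; rewrite fE.
have sf n : energy n (to_field (shift_op T z f)) <= (M ^+ 2 + 1)^-1 * energy n psi.
  rewrite (@eq_energy _ _ n _ (lat M0 M1 M2 z psi)) // => j l _ _.
  by rewrite shift_lat fE.
have sfb : bounded_energy ((M ^+ 2 + 1)^-1 * fine (sqsum f)) (to_field (shift_op T z f)).
  move=> n; apply: le_trans (sf n) _; apply: ler_wpM2l; first exact: ltW.
  by rewrite -fE; exact: l2_energy.
have hsf : l2 (shift_op T z f) by apply/l2P; eexists; exact: sfb.
have := hM _ hsf; rewrite (hS _ hf).2 => le1.
have s0 := fine_sqsum_ge0 f; have s1 := fine_sqsum_ge0 (shift_op T z f).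
have le2 : fine (sqsum f) <= M ^+ 2 * fine (sqsum (shift_op T z f)).
  rewrite -[leLHS]sqr_sqrtr // -[X in _ * X]sqr_sqrtr // -exprMn.
  rewrite ler_sqr ?nnegrE ?sqrtr_ge0 //; exact: le_trans (sqrtr_ge0 _) le1.
have := fine_sqsum_le sfb; rewrite mulrC ler_pdivlMr; last by have := sqr_ge0 M; lra.
have f0 : 0 < fine (sqsum f).
  apply: lt_le_trans (l2_energy hf 0); rewrite fE.
  apply: lt_le_trans (@energy_ge _ _ 0 psi 0 0 _ _) => //.
  by rewrite lt_def vnorm2_ge0 andbT vnorm2_eq0.
have := sqr_ge0 M; nra.
Qed.

End LatticeCoordinates.

(** * The Floquet determinant *)

Section SparseDeterminant.
Variable K : comNzRingType.

Definition mx_of_rows n (rows : seq (seq (option K))) : 'M[K]_n :=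
  \matrix_(i, j) odflt 0 (nth None (nth [::] rows i) j).

(* Laplace expansion along the first row; [None] stands for a zero entry. *)
Fixpoint sparse_det n (rows : seq (seq (option K))) : K :=
  match n, rows with
  | n'.+1, r :: rs =>
    foldr (fun j acc =>
      match nth None r j with
      | None => acc
      | Some a =>
        let minor := sparse_det n' [seq take j s ++ drop j.+1 s | s <- rs] in
        (if odd j then - (a * minor) else a * minor) + acc
      end) 0 (iota 0 n)
  | 0, _ => 1
  | _, _ => 0
  end.

Lemma nth_remove (T : Type) (x0 : T) (s : seq T) j k :
  nth x0 (take j s ++ drop j.+1 s) k = nth x0 s (bump j k).
Proof.
rewrite nth_cat size_take /bump; case: (ltnP j (size s)) => hj.
  case: (ltnP k j) => hk; first by rewrite nth_take.
  by rewrite nth_drop; congr nth; lia.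
case: (ltnP k (size s)) => hk.
  by rewrite nth_take //; [congr nth; lia | lia].
by rewrite nth_drop !nth_default //; lia.
Qed.

Lemma det_rows n rows : size rows = n -> \det (mx_of_rows n rows) = sparse_det n rows.
Proof.
elim: n rows => [|n IH] [|r rs] // sz; first by rewrite det_mx00.
have {}sz : size rs = n by case: sz.
pose G j acc := match nth None r j with
  | None => acc
  | Some a => let minor := sparse_det n [seq take j s ++ drop j.+1 s | s <- rs] in
      (if odd j then - (a * minor) else a * minor) + acc end.
rewrite -[sparse_det _ _]/(foldr G 0 (iota 0 n.+1)) (expand_det_row _ ord0).
pose F j := odflt 0 (nth None r j) * ((-1) ^+ j *
  sparse_det n [seq take j s ++ drop j.+1 s | s <- rs]).
transitivity (\sum_(j < n.+1) F j).
  apply: eq_bigr => j _; rewrite mxE /=; congr (_ * _).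
  rewrite /cofactor add0n; congr (_ * _); rewrite -IH ?size_map //; congr (\det _).
  apply/matrixP => i k; rewrite !mxE /= (nth_map [::]) ?sz //.
  by rewrite nth_remove.
rewrite -(big_mkord predT F) /index_iota subn0.
elim: (iota 0 n.+1) => [|j s IHs]; first by rewrite big_nil.
rewrite big_cons {}IHs /F /= /G; case: (nth None r j) => [a|] /=; last by rewrite mul0r add0r.
congr (_ + _); rewrite -signr_odd; case: (odd j).
  by rewrite expr1 mulN1r mulrN.
by rewrite expr0 mul1r.
Qed.

End SparseDeterminant.

Section HexDeterminant.
Variable K : comNzRingType.
Variables (E l x x' y y' : K).

(** The Floquet matrix with free variables x', y' for the inverses of x, y: the determinant formula
    becomes an identity in any commutative ring, modulo x x' = 1 and y y' = 1. *)
Definition hex_rows : seq (seq (option K)) :=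
  let o := None in
  [:: [:: Some (l - E); o; o; o; Some 1; Some x'; Some y'; o];
      [:: o; Some (l - E); o; o; Some 1; Some 1; o; Some y'];
      [:: o; o; Some (- (2 * l) - E); o; Some 1; o; Some 1; Some x'];
      [:: o; o; o; Some (l - E); o; Some 1; Some 1; Some 1];
      [:: Some 1; Some 1; Some 1; o; Some (- l - E); o; o; o];
      [:: Some x; Some 1; o; Some 1; o; Some (2 * l - E); o; o];
      [:: Some y; o; Some 1; Some 1; o; o; Some (- l - E); o];
      [:: o; Some y; Some x; Some 1; o; o; o; Some (- l - E)]].

Lemma det_hex_rows : x * x' = 1 -> y * y' = 1 ->
  let e := E ^+ 2 in let mu := l ^+ 2 in
  \det (mx_of_rows 8 hex_rows) =
  (x - x' - (y - y') - (x * y' - x' * y)) ^+ 2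
  + 2 * (x + x' + y + y' + x * y' + x' * y) *
    (2 * mu ^+ 2 + mu * (1 - e) - (e - 1) ^+ 2)
  + (e ^+ 4 - 12 * e ^+ 3 + 42 * e ^+ 2 - 52 * e + 21
     + mu * (10 - 39 * e + 36 * e ^+ 2 - 7 * e ^+ 3)
     + mu ^+ 2 * (15 * e ^+ 2 - 36 * e - 3) + mu ^+ 3 * (12 - 13 * e) + 4 * mu ^+ 4).
Proof.
move=> hx hy e mu; rewrite /e /mu det_rows //.
(* Only the list bookkeeping is unfolded; the ring operations stay folded for [ring], which reduces
   modulo the two relations. *)
lazy [sparse_det hex_rows foldr iota nth map take drop cat odd negb].
ring: hx hy.
Qed.

End HexDeterminant.

(** * Signs of the determinant as a function of e and m *)

Section Dispersion.
Variable R : rcfType.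
Implicit Types (e m S J c : R).

Definition kap e m : R := 2 * m ^+ 2 + m * (1 - e) - (e - 1) ^+ 2.

Definition cst e m : R :=
  e ^+ 4 - 12 * e ^+ 3 + 42 * e ^+ 2 - 52 * e + 21
  + m * (10 - 39 * e + 36 * e ^+ 2 - 7 * e ^+ 3)
  + m ^+ 2 * (15 * e ^+ 2 - 36 * e - 3) + m ^+ 3 * (12 - 13 * e) + 4 * m ^+ 4.

Definition disp e m S J : R := - 4 * J + 4 * S * kap e m + cst e m.

(* [disp (E^2) (lambda^2) S J] is the determinant of the Floquet matrix minus
   [E], with [S = cos alpha + cos beta + cos (alpha - beta)] and
   [J = (sin alpha - sin beta - sin (alpha - beta))^2]; [disp0] is its value at
   zero quasimomentum and [dispK] its value at the Dirac points. *)
Definition disp0 e m : R := disp e m 3 0.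
Definition dispK e m : R := disp e m (- (3 / 2)) (27 / 4).

Lemma kapE e m : kap e m = - (e - 1 - m) * (e - 1 + 2 * m).
Proof. rewrite /kap; ring. Qed.

Lemma disp0E e m : let d := e - 1 - m in
  disp0 e m = d ^+ 2 * (d ^+ 2 - (8 + 3 * m) * d - 9 * m).
Proof. rewrite /= /disp0 /disp /cst /kap; ring. Qed.

Lemma dispKE e m : dispK e m = e * (e - 4) ^+ 3
  + m * (4 - 33 * e + 36 * e ^+ 2 - 7 * e ^+ 3)
  + m ^+ 2 * (15 * e ^+ 2 - 36 * e - 15) + m ^+ 3 * (12 - 13 * e) + 4 * m ^+ 4.
Proof. rewrite /dispK /disp /cst /kap; by field. Qed.

Lemma dispME e m : let d := e - 1 - m in
  disp e m (-1) 0 = d * (d * (d - 4) ^+ 2 + m * (48 - 9 * d - 3 * d ^+ 2)).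
Proof. rewrite /= /disp /cst /kap; ring. Qed.

(** Below 1 + m, opposite signs at zero quasimomentum and at the Dirac points force a zero between
    them. Above, the sign at zero suffices, since the saddle or the Dirac points always supply the
    opposite one. *)
Definition lower_band e m := e < 1 + m /\ (dispK e m <= 0 /\ 0 <= disp0 e m).
Definition upper_band e m := 1 + m <= e /\ disp0 e m <= 0.

(** The bound -3/2 comes from |1 + e^(i alpha) + e^(i beta)|^2 >= 0, whose left side is 3 plus twice
    the sum of the three cosines. *)
Lemma circle_bounds (x1 x2 y1 y2 : R) :
  x1 ^+ 2 + x2 ^+ 2 = 1 -> y1 ^+ 2 + y2 ^+ 2 = 1 ->
  [/\ -1 <= x1 <= 1, -1 <= y1 <= 1, -1 <= x1 * y1 + x2 * y2 <= 1 &
      - (3 / 2) <= x1 + y1 + (x1 * y1 + x2 * y2)].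
Proof.
move=> hx hy.
have unit_le (t u : R) : t ^+ 2 + u ^+ 2 = 1 -> -1 <= t <= 1.
  move=> h; rewrite -ler_norml -(@expr_le1 _ 2) ?real_normK ?num_real //.
  by rewrite -h lerDl sqr_ge0.
split; [exact: unit_le hx | exact: unit_le hy | |].
  apply: (unit_le _ (x1 * y2 - x2 * y1)).
  by rewrite -[RHS]mulr1 -{1}hx -hy; ring.
have : 0 <= (x1 + y1 + 1) ^+ 2 + (x2 + y2) ^+ 2 by rewrite addr_ge0 ?sqr_ge0.
have -> : (x1 + y1 + 1) ^+ 2 + (x2 + y2) ^+ 2 =
  (x1 ^+ 2 + x2 ^+ 2) + (y1 ^+ 2 + y2 ^+ 2) + 1 + 2 * (x1 + y1 + (x1 * y1 + x2 * y2)) by ring.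
rewrite hx hy; lra.
Qed.

Section Circle.
Variables (x1 x2 y1 y2 : R).
Hypotheses (hx : x1 ^+ 2 + x2 ^+ 2 = 1) (hy : y1 ^+ 2 + y2 ^+ 2 = 1).

Let S : R := x1 + y1 + (x1 * y1 + x2 * y2).
Let J : R := (x2 - y2 - (x2 * y1 - x1 * y2)) ^+ 2.
(* [a], [b], [c] are the squared sines of [alpha/2], [beta/2], [(alpha - beta)/2]. *)
Let a : R := (1 - x1) / 2.
Let b : R := (1 - y1) / 2.
Let c : R := (1 - (x1 * y1 + x2 * y2)) / 2.

Let Jabc : J = 16 * (a * b * c).
Proof.
have -> : J = x2 ^+ 2 * (1 - y1) ^+ 2 + y2 ^+ 2 * (1 - x1) ^+ 2
  - 2 * x2 * y2 * (1 - x1) * (1 - y1) by rewrite /J; ring.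
have -> : x2 ^+ 2 = 1 - x1 ^+ 2 by rewrite -hx; ring.
have -> : y2 ^+ 2 = 1 - y1 ^+ 2 by rewrite -hy; ring.
rewrite /a /b /c; by field.
Qed.

Let Sabc : S = 3 - 2 * (a + b + c).
Proof. rewrite /S /a /b /c; by field. Qed.

Let abc_bounds : [/\ 0 <= a, 0 <= b, 0 <= c & [/\ a <= 1, b <= 1, c <= 1 & a + b + c <= 9 / 4]].
Proof.
have [/andP[? ?] /andP[? ?] /andP[? ?] ?] := circle_bounds hx hy.
by rewrite /a /b /c; split; [lra|lra|lra|split; lra].
Qed.

Let abc_cube : 27 * (a * b * c) <= (a + b + c) ^+ 3.
Proof.
have [a0 b0 c0 _] := abc_bounds; rewrite -subr_ge0.
have := sqr_ge0 (a - b); have := sqr_ge0 (b - c); have := sqr_ge0 (a - c) => h1 h2 h3.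
have := mulr_ge0 c0 h3; have := mulr_ge0 a0 h2; have := mulr_ge0 b0 h1.
have := mulr_ge0 a0 h3; have := mulr_ge0 b0 h3; have := mulr_ge0 c0 h2.
have := mulr_ge0 b0 h2; have := mulr_ge0 a0 h1; have := mulr_ge0 c0 h1; nra.
Qed.

(** Decides which quasimomentum is extremal: the cubic term lowers the determinant, the linear one
    lowers it when [kap] is positive and raises it when [kap] is negative. *)
Let disp_abc e m : disp e m S J = disp0 e m - 64 * (a * b * c) - 8 * kap e m * (a + b + c).
Proof. by rewrite /disp0 /disp Sabc Jabc; ring. Qed.

Lemma disp_le0 e m : 0 <= kap e m -> disp e m S J <= disp0 e m.
Proof.
move=> k0; have [a0 b0 c0 _] := abc_bounds.
have := mulr_ge0 k0 (addr_ge0 (addr_ge0 a0 b0) c0).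
have := mulr_ge0 (mulr_ge0 a0 b0) c0; rewrite disp_abc; nra.
Qed.

(** As a b c <= c <= a + b + c, the linear gain dominates 64 a b c once [- kap] reaches 8. *)
Lemma disp_ge0 e m : kap e m <= - 8 -> disp0 e m <= disp e m S J.
Proof.
move=> k8; have [a0 b0 c0 [a1 b1 c1 _]] := abc_bounds.
have ab : a * b <= 1 by rewrite -[leRHS]mulr1 ler_pM.
have abc : a * b * c <= c by rewrite -[leRHS]mul1r ler_wpM2r.
have h : 0 <= (- 8 - kap e m) * (a + b + c).
  by apply: mulr_ge0; rewrite ?subr_ge0 // !addr_ge0.
rewrite disp_abc; nra.
Qed.

(** At the Dirac points a = b = c = 3/4, and a + b + c attains its maximum 9/4. AM-GM with this
    maximum gives 64 a b c <= 12 (a + b + c); the slope 12 against 8 [kap] explains the threshold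
    -3/2. *)
Lemma disp_geK e m : - (3 / 2) <= kap e m <= 0 -> dispK e m <= disp e m S J.
Proof.
move=> /andP[k1 k0]; have [a0 b0 c0 [_ _ _ s94]] := abc_bounds.
have -> : dispK e m = disp0 e m - 27 - 18 * kap e m by rewrite /dispK /disp0 /disp; by field.
rewrite disp_abc.
set s := a + b + c in s94 *; have s0 : 0 <= s by rewrite !addr_ge0.
have h1 : 16 * (a * b * c) <= 3 * s.
  have := abc_cube; rewrite -/s => h.
  have : s ^+ 2 <= 81 / 16 by nra.
  move=> h2; have : s ^+ 3 <= 81 / 16 * s by rewrite exprSr ler_wpM2r.
  lra.
have h2 : 0 <= (kap e m + 3 / 2) * (9 / 4 - s) by apply: mulr_ge0; lra.
nra.
Qed.

End Circle.

Lemma small_powers m : 0 < m -> m <= (1 / 100) ^+ 2 ->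
  [/\ 0 <= m ^+ 2, 0 <= m ^+ 3, 0 <= m ^+ 4 &
   [/\ m ^+ 2 <= (1 / 100) ^+ 2 * m, m ^+ 3 <= m ^+ 2 & m ^+ 4 <= m ^+ 2]].
Proof.
move=> m0 m1; have h (k : nat) : 0 <= m ^+ k by rewrite exprn_ge0 // ltW.
have le1 : m <= 1 by lra.
split=> //; split; first by rewrite expr2 ler_pM2r.
  by rewrite exprS ler_piMl.
by rewrite (exprD m 2 2) ler_piMl // expr_le1 // ltW.
Qed.

(** At m = 0 the value is e (e - 4)^3, at most -5 on this range, and the corrections are O(m). *)
Lemma dispK_mid m e (m0 : 0 < m) (m1 : m <= (1 / 100) ^+ 2) : 1 / 2 <= e -> e <= 1 + m -> dispK e m < 0.
Proof.
move=> e1 e2; rewrite dispKE.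
have h1 : e * (e - 4) ^+ 3 <= - 5.
  have h : 2 <= 4 - e by lra.
  have h2 : 4 <= (4 - e) ^+ 2 by nra.
  have h3 : 8 <= (4 - e) ^+ 3 by rewrite exprS; nra.
  have -> : e * (e - 4) ^+ 3 = - (e * (4 - e) ^+ 3) by ring.
  have h4 : 12 <= (4 - e) ^+ 3.
    have h5 : 5 / 2 <= 4 - e by lra.
    have h6 : 25 / 4 <= (4 - e) ^+ 2 by nra.
    by rewrite exprS; nra.
  nra.
have e2' : e <= 2 by lra.
have h2 : 4 - 33 * e + 36 * e ^+ 2 - 7 * e ^+ 3 <= 200.
  have : 0 <= e ^+ 3 by rewrite exprn_ge0 //; lra.
  nra.
have h3 : 15 * e ^+ 2 - 36 * e - 15 <= 60 by nra.
have h4 : 12 - 13 * e <= 12 by lra.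
have := ler_wpM2l (ltW m0) h2.
have := ler_wpM2l (sqr_ge0 m) h3.
have := ler_wpM2l (exprn_ge0 3 (ltW m0)) h4.
have [? ? ? [? ? ?]] := small_powers m0 m1; lra.
Qed.

Lemma dispK_mono m e1 e2 (m0 : 0 < m) (m1 : m <= (1 / 100) ^+ 2) : 0 <= e1 -> e1 <= e2 -> e2 <= 1 / 2 -> dispK e2 m <= dispK e1 m.
Proof.
move=> h0 h1 h2; rewrite -subr_ge0 !dispKE.
(* The difference quotient with its sign reversed; 64 - 48 (e1 + e2) >= 16 dominates because e1 + e2
   <= 1. *)
pose q := 64 - 48 * (e1 + e2) + 12 * (e1 ^+ 2 + e1 * e2 + e2 ^+ 2)
   - (e1 + e2) * (e1 ^+ 2 + e2 ^+ 2)
   + m * (33 - 36 * (e1 + e2) + 7 * (e1 ^+ 2 + e1 * e2 + e2 ^+ 2))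
   + m ^+ 2 * (36 - 15 * (e1 + e2)) + 13 * m ^+ 3.
rewrite [leRHS](_ : _ = (e2 - e1) * q); last by rewrite /q; ring.
apply: mulr_ge0; first lra.
have a1 : 0 <= e1 ^+ 2 <= 1 / 4 by apply/andP; split; nra.
have a2 : 0 <= e2 ^+ 2 <= 1 / 4 by apply/andP; split; nra.
move/andP: a1 => [a1 a1']; move/andP: a2 => [a2 a2'].
have a3 : 0 <= e1 * e2 by apply: mulr_ge0; lra.
have b1 : (e1 + e2) * (e1 ^+ 2 + e2 ^+ 2) <= 1 * (1 / 2) by apply: ler_pM; lra.
have b2 : 0 <= m * (3 + 33 - 36 * (e1 + e2) + 7 * (e1 ^+ 2 + e1 * e2 + e2 ^+ 2)).
  by apply: mulr_ge0; lra.
have b3 : 0 <= m ^+ 2 * (36 - 15 * (e1 + e2)) by apply: mulr_ge0; [exact: sqr_ge0 | lra].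
have b4 : 0 <= m ^+ 3 by exact: exprn_ge0 (ltW m0).
rewrite /q; lra.
Qed.

(** To first order the value is 4 m - 64 e, positive for e < m/16; the smaller m/25 leaves room for
    the remainder. *)
Lemma dispK_small m e (m0 : 0 < m) (m1 : m <= (1 / 100) ^+ 2) : 0 <= e -> e <= m / 25 -> 0 < dispK e m.
Proof.
move=> e0 e1; rewrite dispKE.
have h1 : e <= 1 / 100 by lra.
have e3 : 0 <= e ^+ 3 <= e.
  apply/andP; split; first exact: exprn_ge0.
  have : e ^+ 2 <= 1 by nra.
  by rewrite exprS; nra.
move/andP: e3 => [e3 e3'].
have -> : e * (e - 4) ^+ 3 = e ^+ 4 + 48 * e ^+ 2 - 12 * (e * e ^+ 2) - 64 * e by ring.
have h2 : 0 <= e ^+ 4 by exact: exprn_ge0.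
have h3 : 0 <= e ^+ 2 * (48 - 12 * e) by apply: mulr_ge0; [exact: sqr_ge0 | lra].
have h4 : 0 <= m * (m - 25 * e) by apply: mulr_ge0; lra.
have h5 : 0 <= m * (e - e ^+ 3) by apply: mulr_ge0; lra.
have h6 : 0 <= m * (36 * e ^+ 2) by rewrite !mulr_ge0 ?sqr_ge0 // ltW.
have h7 : 0 <= m ^+ 2 * (15 * e ^+ 2).
  by apply: mulr_ge0; [exact: sqr_ge0 | apply: mulr_ge0 => //; exact: sqr_ge0].
have h8 : 0 <= m ^+ 2 * (1 - 36 * e) by apply: mulr_ge0; [exact: sqr_ge0 | lra].
have h9 : 0 <= m ^+ 3 * (12 - 13 * e) by apply: mulr_ge0; [exact: exprn_ge0 (ltW m0) | lra].
have h10 : 0 <= m ^+ 4 by exact: exprn_ge0 (ltW m0).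
have [? ? ? [? ? ?]] := small_powers m0 m1; lra.
Qed.

(** The first-order part 4 m - 64 e vanishes here, and the coefficient of m^2, about -17, decides
    the sign. *)
Lemma dispK_sixteenth m (m0 : 0 < m) (m1 : m <= (1 / 100) ^+ 2) : dispK (m / 16) m <= 0.
Proof.
rewrite dispKE; have [? ? ? [? ? ?]] := small_powers m0 m1; lra.
Qed.

Lemma dispK_large m e (m0 : 0 < m) (m1 : m <= (1 / 100) ^+ 2) : 9 / 2 <= e -> e <= 11 -> 0 <= dispK e m.
Proof.
move=> e1 e2; rewrite dispKE.
have u3 : 1 / 8 <= (e - 4) ^+ 3.
  have : 1 / 4 <= (e - 4) ^+ 2 by nra.
  by rewrite exprS; nra.
have h1 : (1 / 8) * e <= e * (e - 4) ^+ 3 by rewrite mulrC ler_pM2l //; lra.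
have h2 : - 847 * e <= 4 - 33 * e + 36 * e ^+ 2 - 7 * e ^+ 3.
  have : e ^+ 3 <= 121 * e by rewrite exprSr ler_wpM2r //; nra.
  nra.
have h3 : 0 <= m ^+ 2 * (15 * e ^+ 2 - 36 * e - 15) by apply: mulr_ge0; [exact: sqr_ge0 | nra].
have h4 : - 131 <= 12 - 13 * e by lra.
have := ler_wpM2l (ltW m0) h2; have := ler_wpM2l (exprn_ge0 3 (ltW m0)) h4.
have [? ? ? [? ? ?]] := small_powers m0 m1.
have : m * e <= (1 / 100) ^+ 2 * e by rewrite ler_wpM2r //; lra.
lra.
Qed.

(** For d in (- 11/10 m, 0) the term -8 d is below 8.8 m and cannot offset -9 m. *)
Lemma disp0_neg m e (m0 : 0 < m) (m1 : m <= (1 / 100) ^+ 2) : 1 - m / 10 < e -> e < 1 + m -> disp0 e m < 0.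
Proof.
move=> e1 e2; rewrite disp0E; set d := e - 1 - m.
have d0 : d < 0 by rewrite /d; lra.
have d1 : - (11 / 10 * m) < d by rewrite /d; lra.
rewrite pmulr_rlt0; last by rewrite exprn_even_gt0 //= lt_eqF.
nra.
Qed.

(** A rough converse of [disp0_neg], used to place e above 1 - 2 m, where [kap] is nonnegative. *)
Lemma disp0_neg_near m e (m0 : 0 < m) (m1 : m <= (1 / 100) ^+ 2) : e < 1 + m -> disp0 e m < 0 -> 1 - m < e.
Proof.
move=> e2; rewrite disp0E; set d := e - 1 - m.
have d0 : d < 0 by rewrite /d; lra.
rewrite pmulr_rlt0; last by rewrite exprn_even_gt0 //= lt_eqF.
move=> h; have : - (2 * m) < d by nra.
rewrite /d; lra.
Qed.

Lemma disp0_half m (m0 : 0 < m) (m1 : m <= (1 / 100) ^+ 2) : 0 <= disp0 (1 - m / 2) m.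
Proof.
rewrite disp0E; apply: mulr_ge0; first exact: sqr_ge0.
nra.
Qed.

Lemma disp0_mono m e1 e2 (m0 : 0 < m) (m1 : m <= (1 / 100) ^+ 2) : e1 <= e2 -> e2 < 1 + m -> 0 <= disp0 e2 m -> 0 <= disp0 e1 m.
Proof.
move=> h1 h2; rewrite !disp0E; set d2 := e2 - 1 - m; set d1 := e1 - 1 - m.
have d20 : d2 < 0 by rewrite /d2; lra.
have d12 : d1 <= d2 by rewrite /d1 /d2; lra.
rewrite pmulr_rge0; last by rewrite exprn_even_gt0 //= lt_eqF.
move=> h; apply: mulr_ge0; first exact: sqr_ge0.
have : 0 <= (d2 - d1) * (8 + 3 * m - (d1 + d2)) by apply: mulr_ge0; lra.
nra.
Qed.

Lemma disp0_edge m (m0 : 0 < m) (m1 : m <= (1 / 100) ^+ 2) : disp0 (1 + m) m = 0.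
Proof. rewrite disp0E; ring. Qed.

(** The positive root of d^2 - (8 + 3 m) d - 9 m lies just above 8, so d <= 9. *)
Lemma disp0_upper_le m e (m0 : 0 < m) (m1 : m <= (1 / 100) ^+ 2) : 1 + m <= e -> disp0 e m <= 0 -> e <= 11.
Proof.
move=> h1; rewrite disp0E; set d := e - 1 - m => h.
have d0 : 0 <= d by rewrite /d; lra.
rewrite leNgt; apply/negP => h2.
have d9 : 9 < d by rewrite /d; lra.
move: h; apply/negP; rewrite -ltNge mulr_gt0 //; first by rewrite exprn_gt0 //; lra.
nra.
Qed.

(** The second factor divided by d, that is d - (8 + 3 m) - 9 m / d, increases with d > 0; the
    identity in the proof clears the denominators. *)
Lemma disp0_upper_mono m e1 e2 (m0 : 0 < m) (m1 : m <= (1 / 100) ^+ 2) : 1 + m <= e1 -> e1 <= e2 -> disp0 e2 m <= 0 -> disp0 e1 m <= 0.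
Proof.
move=> h1 h2; rewrite !disp0E; set d2 := e2 - 1 - m; set d1 := e1 - 1 - m => h.
have d0 : 0 <= d1 by rewrite /d1; lra.
have d12 : d1 <= d2 by rewrite /d1 /d2; lra.
apply: mulr_ge0_le0; first exact: sqr_ge0.
have [d20|] := ltP 0 d2; last first.
  move=> d20; have d10 : d1 = 0 by lra.
  rewrite d10; lra.
move: h; rewrite pmulr_rle0 ?exprn_gt0 // => h.
rewrite -(pmulr_rle0 _ d20).
have -> : d2 * (d1 ^+ 2 - (8 + 3 * m) * d1 - 9 * m) =
   d1 * (d2 ^+ 2 - (8 + 3 * m) * d2 - 9 * m) - (d2 - d1) * (9 * m + d1 * d2) by ring.
have : d1 * (d2 ^+ 2 - (8 + 3 * m) * d2 - 9 * m) <= 0 by apply: mulr_ge0_le0.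
have : 0 <= (d2 - d1) * (9 * m + d1 * d2).
  by apply: mulr_ge0; [lra | apply: addr_ge0; [lra | apply: mulr_ge0; lra]].
lra.
Qed.

(** Outside the bands e falls into one of the three regimes of [kap], and the modulus of the
    extremal value serves as delta. *)
Lemma disp_nonzero m e (m0 : 0 < m) (m1 : m <= (1 / 100) ^+ 2) : 0 <= e -> ~ lower_band e m -> ~ upper_band e m ->
  exists2 delta : R, 0 < delta & forall x1 x2 y1 y2 : R,
    x1 ^+ 2 + x2 ^+ 2 = 1 -> y1 ^+ 2 + y2 ^+ 2 = 1 ->
    delta <= `|disp e m (x1 + y1 + (x1 * y1 + x2 * y2))
                       ((x2 - y2 - (x2 * y1 - x1 * y2)) ^+ 2)|.
Proof.
move=> e0 nl nu; have [e1|e1] := ltP e (1 + m); last first.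
  have h : 0 < disp0 e m by rewrite ltNge; apply/negP => h; apply: nu.
  exists (disp0 e m) => // x1 x2 y1 y2 hx hy.
  apply: le_trans (ler_norm _); apply: disp_ge0 => //.
  (* Above the upper band, [disp0] positive forces d = 0 or d > 8; the former is excluded, and the
     latter gives [kap] = - d (d + 3 m) <= -8. *)
  move: h; rewrite disp0E kapE; set d := e - 1 - m.
  have d0 : 0 <= d by rewrite /d; lra.
  have [->|dn0] := eqVneq d 0; first by rewrite expr0n /= mul0r ltxx.
  have {}d0 : 0 < d by rewrite lt_def dn0.
  rewrite pmulr_rgt0 ?exprn_gt0 // => h.
  have d8 : 8 < d by nra.
  have -> : e - 1 + 2 * m = d + 3 * m by rewrite /d; ring.
  nra.
have [hK|hK] := lerP (dispK e m) 0.
  have h0 : disp0 e m < 0.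
    by rewrite ltNge; apply/negP => h; apply: nl.
  exists (- disp0 e m) => [|x1 x2 y1 y2 hx hy]; first by rewrite oppr_gt0.
  rewrite -normrN; apply: le_trans (ler_norm _).
  have h1 := disp0_neg_near m0 m1 e1 h0.
  rewrite lerN2; apply: disp_le0 => //.
  rewrite kapE mulNr oppr_ge0; apply: mulr_le0_ge0; lra.
exists (dispK e m) => // x1 x2 y1 y2 hx hy.
apply: le_trans (ler_norm _); apply: disp_geK => //.
(* A positive Dirac value excludes the range of [dispK_mid]; for 0 <= e < 1/2, [kap] lies in
   [-3/2, 0]. *)
have e2 : e < 1 / 2.
  by rewrite ltNge; apply/negP => h; have := dispK_mid m0 m1 h (ltW e1); rewrite ltNge ltW.
rewrite kapE; apply/andP; split; nra.
Qed.

(* The quasimomenta [beta = - alpha] with [c = cos alpha] pass through zero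
   ([c = 1]), a Dirac point ([c = - 1/2]) and a saddle point ([c = -1]). *)
Lemma disp_zero m e (m0 : 0 < m) (m1 : m <= (1 / 100) ^+ 2) : 0 <= e -> lower_band e m \/ upper_band e m ->
  exists2 c : R, -1 <= c <= 1 &
    disp e m (2 * c ^+ 2 + 2 * c - 1) (4 * (1 - c ^+ 2) * (1 - c) ^+ 2) = 0.
Proof.
move=> e0 h.
pose p : {poly R} := (- 16)%:P * (1 - 'X * 'X) * ((1 - 'X) * (1 - 'X))
   + (4 * kap e m)%:P * (2%:P * 'X * 'X + 2%:P * 'X - 1) + (cst e m)%:P.
have pE c : p.[c] = disp e m (2 * c ^+ 2 + 2 * c - 1) (4 * (1 - c ^+ 2) * (1 - c) ^+ 2).
  rewrite /p /disp; move: (kap e m) (cst e m) => k d.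
  transitivity (- 16 * (1 - c * c) * ((1 - c) * (1 - c)) + 4 * k * (2 * c * c + 2 * c - 1) + d).
    by rewrite !hornerE.
  ring.
have p1 : p.[1] = disp0 e m by rewrite pE /disp0; congr disp; ring.
have pK : p.[- (1 / 2)] = dispK e m by rewrite pE /dispK; congr disp; by field.
have pM : p.[-1] = disp e m (-1) 0 by rewrite pE; congr disp; ring.
have root_of a b : -1 <= a -> a <= b -> b <= 1 -> 0 <= p.[a] * -1 -> 0 <= p.[b] ->
    exists2 c, -1 <= c <= 1 & p.[c] = 0.
  move=> a1 ab b1 ha hb.
  have [|c /andP[ac cb] /rootP c0] := @poly_ivt R p a b ab.
    by apply/andP; split => //; lra.
  by exists c => //; apply/andP; split; [exact: le_trans ac | exact: le_trans b1].
have root_of' a b : -1 <= a -> a <= b -> b <= 1 -> 0 <= p.[a] -> p.[b] <= 0 ->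
    exists2 c, -1 <= c <= 1 & p.[c] = 0.
  move=> a1 ab b1 ha hb.
  have [|c /andP[ac cb] /rootP c0] := @poly_ivt R (- p) a b ab.
    by rewrite !hornerN; apply/andP; split; lra.
  exists c; first by apply/andP; split; [exact: le_trans ac | exact: le_trans b1].
  by apply/eqP; rewrite -oppr_eq0 -hornerN c0.
suff [c hc pc] : exists2 c, -1 <= c <= 1 & p.[c] = 0 by exists c; rewrite // -pE.
case: h => [[e1 [hK h0]]|[e1 h0]].
  by apply: (root_of (- (1 / 2)) 1); rewrite ?p1 ?pK; lra.
have e11 := disp0_upper_le m0 m1 e1 h0.
(* The Dirac value, about e (e - 4)^3, is positive only beyond e = 4; the saddle value, about d (d -
   4)^2, degenerates at d = 4, near e = 5. The cut 9/2 keeps away from both. *)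
have [e2|e2] := lerP e (9 / 2); last first.
  by apply: (root_of' (- (1 / 2)) 1); rewrite ?p1 ?pK //;
    try apply: (dispK_large m0 m1); lra.
have m11 : -1 <= 1 :> R by lra.
apply: (root_of' (-1) 1 (lexx _) m11 (lexx _)); rewrite ?p1 //.
rewrite pM dispME; set d := e - 1 - m.
have d0 : 0 <= d by rewrite /d; lra.
have d1 : d <= 7 / 2 by rewrite /d; lra.
apply: mulr_ge0 => //.
have [d2|d2] := lerP d (5 / 2).
  apply: addr_ge0; first by apply: mulr_ge0 => //; exact: sqr_ge0.
  by apply: mulr_ge0; [exact: ltW | nra].
have h1 : 1 / 4 <= (d - 4) ^+ 2 by nra.
have h2 : 5 / 8 <= d * (d - 4) ^+ 2 by nra.
have h3 : - 30 <= 48 - 9 * d - 3 * d ^+ 2 by nra.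
have := ler_wpM2l (ltW m0) h3; lra.
Qed.

End Dispersion.

(** * The hexagonal lattice as a lattice of 8-vertex cells *)

Section HexGeometry.
Variable R : realType.
Implicit Types (n m j l : int) (s : bool).

Definition hex_pos n m s : R * R :=
  (if s then a1 else 0) + bplus *~ n + bminus *~ m.

Lemma hex_posP n m s : hex_lattice (hex_pos n m s).
Proof.
case: s; first by right; exists n, m.
by left; exists n, m; rewrite /hex_pos add0r.
Qed.

Definition vertex n m s : hex_vertex R := exist _ (hex_pos n m s) (mem_set (hex_posP n m s)).

Lemma hex_pos1 n m s : (hex_pos n m s).1 = s%:R + 3 / 2 * (n + m)%:~R.
Proof.
rewrite -[LHS]/((if s then a1 else 0).1 + (bplus *~ n).1 + (bminus *~ m).1).
have mulz (p : R * R) (k : int) : (p *~ k).1 = p.1 * k%:~R.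
  by rewrite mulrzr; exact: (raddfMz (@fst R R)).
rewrite !mulz -[bplus.1]/(3 / 2) -[bminus.1]/(3 / 2) intrD.
have -> : (if s then a1 else 0).1 = s%:R :> R by case: s.
ring.
Qed.

Lemma hex_pos2 n m s : (hex_pos n m s).2 = Num.sqrt 3 / 2 * (n - m)%:~R.
Proof.
rewrite -[LHS]/((if s then a1 else 0).2 + (bplus *~ n).2 + (bminus *~ m).2).
have mulz (p : R * R) (k : int) : (p *~ k).2 = p.2 * k%:~R.
  by rewrite mulrzr; exact: (raddfMz (@snd R R)).
rewrite !mulz -[bplus.2]/(Num.sqrt 3 / 2) -[bminus.2]/(- (Num.sqrt 3 / 2)) intrB.
have -> : (if s then a1 else 0).2 = 0 :> R by case: s.
ring.
Qed.

Lemma sqrt3_gt0 : 0 < Num.sqrt 3 / 2 :> R.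
Proof. by rewrite divr_gt0 // sqrtr_gt0. Qed.

Lemma intr_bool s : (s%:Z)%:~R = s%:R :> R.
Proof. by case: s. Qed.

Lemma vertex_inj n m s n' m' s' :
  vertex n m s = vertex n' m' s' -> [/\ n = n', m = m' & s = s'].
Proof.
move=> e; have {}e : hex_pos n m s = hex_pos n' m' s' by exact: (congr1 val e).
have := congr1 fst e; have := congr1 snd e.
rewrite !hex_pos1 !hex_pos2 => /(mulfI (lt0r_neq0 sqrt3_gt0))/intr_inj e2 e1.
have h1 : 2 * s%:Z + 3 * (n + m) = 2 * s'%:Z + 3 * (n' + m').
  by apply: (@intr_inj R); rewrite !intrD in e1; rewrite !(intrD, intrM) !intr_bool; lra.
by clear e e1; case: s s' h1 => -[] h1; split => //; lia.
Qed.

(** Four times the squared distance is (3 p + 2 t)^2 + 3 q^2: the root of 3 enters only squared, so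
    adjacency becomes an integer equation. *)
Lemma hex_adjE n m s n' m' s' :
  let p := n + m - (n' + m') in let q := n - m - (n' - m') in let t := s%:Z - s'%:Z in
  hex_adj (vertex n m s) (vertex n' m' s') <->
  9 * p ^+ 2 + 12 * p * t + 4 * t ^+ 2 + 3 * q ^+ 2 = 4.
Proof.
move=> p q t; rewrite /hex_adj /euclid_dist.
rewrite -[val (vertex n m s)]/(hex_pos n m s) -[val (vertex n' m' s')]/(hex_pos n' m' s').
rewrite !hex_pos1 !hex_pos2; set X := (_ + _).
have X0 : 0 <= X by rewrite addr_ge0 ?sqr_ge0.
have XE : X * 4 = (9 * p ^+ 2 + 12 * p * t + 4 * t ^+ 2 + 3 * q ^+ 2)%:~R.
  have s3 : Num.sqrt 3 ^+ 2 = 3 :> R by rewrite sqr_sqrtr.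
  have -> : X = (s%:R - s'%:R + 3 / 2 * p%:~R) ^+ 2 + Num.sqrt 3 ^+ 2 / 4 * q%:~R ^+ 2.
    by rewrite /X /p /q !(intrD, intrB); field.
  have -> : s%:R - s'%:R = t%:~R :> R by rewrite /t intrB !intr_bool.
  by rewrite s3; clearbody p q t; field.
split=> [h|h].
  have X1 : X = 1 by rewrite -(sqr_sqrtr X0) h expr1n.
  by apply: (@intr_inj R); rewrite -XE X1 mul1r.
have X1 : X = 1.
  have : X * 4 = 4 by rewrite XE h.
  by move=> h4; lra.
by rewrite X1 sqrtr1.
Qed.

Lemma hex_adjI n m s n' m' s' (p q t : int) :
  n + m - (n' + m') = p -> n - m - (n' - m') = q -> s%:Z - s'%:Z = t ->
  9 * p ^+ 2 + 12 * p * t + 4 * t ^+ 2 + 3 * q ^+ 2 = 4 ->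
  hex_adj (vertex n m s) (vertex n' m' s').
Proof. by move=> <- <- <- h; apply/hex_adjE. Qed.

Lemma vertexP (v : hex_vertex R) : exists n m s, v = vertex n m s.
Proof.
have [[n [m e]]|[n [m e]]] := set_mem (valP v).
  by exists n, m, false; apply: val_inj; rewrite e -[RHS]/(hex_pos n m false) /hex_pos add0r.
by exists n, m, true; apply: val_inj; rewrite e.
Qed.

(** Since 3 q^2 <= 4, q is 0 or a unit and (3 p + 2 t)^2 is 4 or 1; modulo 3 this excludes t = 0. *)
Lemma hex_diff (p q t : int) : t = 1 \/ t = 0 \/ t = -1 ->
  9 * p ^+ 2 + 12 * p * t + 4 * t ^+ 2 + 3 * q ^+ 2 = 4 ->
  t != 0 /\ (p = 0 /\ q = 0 \/ p = - t /\ (q = 1 \/ q = -1)).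
Proof.
rewrite !expr2 => ht h.
have q2 : 0 <= q * q by rewrite -expr2 sqr_ge0.
have [qe|[qe|qe]] : q = 0 \/ (q = 1 \/ q = -1) \/ 4 <= q * q by nia.
- move: h; rewrite qe; case: ht => [->|[->|->]] h; split => //; nia.
- case: ht => [te|[te|te]]; rewrite te in h *; split => //; move: h; case: qe => -> h; nia.
- exfalso; case: ht => [te|[te|te]]; rewrite te in h; nia.
Qed.

Lemma hex_adj_false n m : [set v | hex_adj (vertex n m false) v] =
  [set` [:: vertex n m true; vertex (n - 1) m true; vertex n (m - 1) true]].
Proof.
apply/seteqP; split=> v; have [n' [m' [s' ->]]] := vertexP v; rewrite /= !inE.
  move=> /hex_adjE /hex_diff[|h1 h2]; first by case: s'; [right; right | right; left].
  case: s' h1 h2 => // _ [[h1 h2]|[h1 [h2|h2]]].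
  - by apply/or3P/Or31/eqP; congr vertex; lia.
  - by apply/or3P/Or32/eqP; congr vertex; lia.
  - by apply/or3P/Or33/eqP; congr vertex; lia.
case/or3P => /eqP/vertex_inj[-> -> ->].
- by apply: (@hex_adjI _ _ _ _ _ _ 0 0 (-1)) => //; lia.
- by apply: (@hex_adjI _ _ _ _ _ _ 1 1 (-1)) => //; lia.
- by apply: (@hex_adjI _ _ _ _ _ _ 1 (-1) (-1)) => //; lia.
Qed.

Lemma hex_adj_true n m : [set v | hex_adj (vertex n m true) v] =
  [set` [:: vertex n m false; vertex (n + 1) m false; vertex n (m + 1) false]].
Proof.
apply/seteqP; split=> v; have [n' [m' [s' ->]]] := vertexP v; rewrite /= !inE.
  move=> /hex_adjE /hex_diff[|h1 h2]; first by case: s'; [right; left | left].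
  case: s' h1 h2 => // _ [[h1 h2]|[h1 [h2|h2]]].
  - by apply/or3P/Or31/eqP; congr vertex; lia.
  - by apply/or3P/Or33/eqP; congr vertex; lia.
  - by apply/or3P/Or32/eqP; congr vertex; lia.
case/or3P => /eqP/vertex_inj[-> -> ->].
- by apply: (@hex_adjI _ _ _ _ _ _ 0 0 1) => //; lia.
- by apply: (@hex_adjI _ _ _ _ _ _ (-1) (-1) 1) => //; lia.
- by apply: (@hex_adjI _ _ _ _ _ _ (-1) 1 1) => //; lia.
Qed.

Lemma fsbig3 (V : choiceType) (M : nmodType) (a b c : V) (f : V -> M) :
  a != b -> a != c -> b != c ->
  \sum_(v \in [set` [:: a; b; c]]) f v = f a + f b + f c.
Proof.
move=> ab ac bc; rewrite -fsbig_seq /=; last by rewrite !inE negb_or ab ac bc.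
by rewrite !big_cons big_nil addr0 addrA.
Qed.

Lemma vertex_neq n m s n' m' s' : (n != n') || (m != m') -> vertex n m s != vertex n' m' s'.
Proof. by move=> h; apply/eqP => /vertex_inj[e1 e2 _]; move: h; rewrite e1 e2 !eqxx. Qed.

Lemma laplacian_false (f : hex_vertex R -> R[i]) n m :
  hex_laplacian f (vertex n m false) =
  f (vertex n m true) + f (vertex (n - 1) m true) + f (vertex n (m - 1) true).
Proof. by rewrite /hex_laplacian hex_adj_false fsbig3 //; apply: vertex_neq; lia. Qed.

Lemma laplacian_true (f : hex_vertex R -> R[i]) n m :
  hex_laplacian f (vertex n m true) =
  f (vertex n m false) + f (vertex (n + 1) m false) + f (vertex n (m + 1) false).
Proof. by rewrite /hex_laplacian hex_adj_true fsbig3 //; apply: vertex_neq; lia. Qed.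

(* The 8 vertices of the cell [(j, l)] are numbered by the binary digits of [i]:
   parity along [bplus], parity along [bminus], sublattice. *)
Definition site (j l : int) (i : 'I_8) : hex_vertex R :=
  vertex (2 * j + (odd i)%:Z) (2 * l + (odd i./2)%:Z) (4 <= i)%N.

Lemma ord8_eq (i i' : 'I_8) :
  odd i = odd i' -> odd i./2 = odd i'./2 -> (4 <= i)%N = (4 <= i')%N -> i = i'.
Proof. by move=> h1 h2 h3; apply: val_inj => /=; have := ltn_ord i; have := ltn_ord i'; lia. Qed.

Lemma site_inj j l i j' l' i' : site j l i = site j' l' i' -> [/\ j = j', l = l' & i = i'].
Proof.
case/vertex_inj => h1 h2 h3.
have e1 : odd i = odd i' by case: (odd i) (odd i') h1 => -[] h1 //; lia.
have e2 : odd i./2 = odd i'./2 by case: (odd i./2) (odd i'./2) h2 => -[] h2 //; lia.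
split; [by rewrite e1 in h1; lia | by rewrite e2 in h2; lia | exact: ord8_eq].
Qed.

Lemma site_surj (v : hex_vertex R) : exists p : int * int * 'I_8, site p.1.1 p.1.2 p.2 = v.
Proof.
have [n [m [s ->]]] := vertexP v.
have parity (k : int) : exists j (b : bool), k = 2 * j + b%:Z.
  exists (k %/ 2)%Z, ((k %% 2)%Z == 1); have := divz_eq k 2.
  have := @modz_ge0 k 2 isT; have := @ltz_pmod k 2 isT.
  by case: eqP => ? ? ? ?; lia.
have [j [a ->]] := parity n; have [l [b ->]] := parity m.
have hi : (a + 2 * b + 4 * s < 8)%N by case: a b s => -[] [].
exists (j, l, Ordinal hi); rewrite /site /=.
by clear; case: a b s => -[] [].
Qed.

End HexGeometry.

(** * The Schrodinger operator in cell coordinates *)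

Section HexOperator.
Variable R : realType.
Local Notation C := R[i].

(* In the order of [site], that is q1, q3, q5, q7, q2, q4, q6, q8. *)
Definition cell_values : seq R := [:: 1; 1; -2; 1; -1; 2; -1; -1].

Definition hexM0 (lam : R) : 'M[C]_8 :=
  let o := None in let I := Some (1 : C) in
  let q k := Some ((lam * nth 0 cell_values k)%:C) in
  mx_of_rows 8
  [:: [:: q 0%N; o; o; o; I; o; o; o];
      [:: o; q 1%N; o; o; I; I; o; o];
      [:: o; o; q 2%N; o; I; o; I; o];
      [:: o; o; o; q 3%N; o; I; I; I];
      [:: I; I; I; o; q 4%N; o; o; o];
      [:: o; I; o; I; o; q 5%N; o; o];
      [:: o; o; I; I; o; o; q 6%N; o];
      [:: o; o; o; I; o; o; o; q 7%N]].

(** Bonds leaving a cell forwards: (i, k) joins component i to component k of the next cell.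
    Backward bonds come from the adjoint matrices. *)
Definition row_hop (i k : nat) : nat := match i, k with 5, 0 | 7, 2 => 1 | _, _ => 0 end.
Definition col_hop (i k : nat) : nat := match i, k with 6, 0 | 7, 1 => 1 | _, _ => 0 end.

Definition hexM1 : 'M[C]_8 := \matrix_(i, k) (row_hop i k)%:R.
Definition hexM2 : 'M[C]_8 := \matrix_(i, k) (col_hop i k)%:R.

Lemma hexM0_herm lam : adjmx (hexM0 lam) = hexM0 lam.
Proof.
apply/matrixP => i k; rewrite !mxE.
by case: i => [[|[|[|[|[|[|[|[|i]]]]]]]] hi] //;
   case: k => [[|[|[|[|[|[|[|[|k]]]]]]]] hk] //;
   apply/eqP; rewrite eq_complex /= ?oppr0 !eqxx.
Qed.

Lemma adj_natmx (F : 'I_8 -> 'I_8 -> nat) :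
  adjmx (\matrix_(i, k) (F i k)%:R : 'M[C]_8) = \matrix_(i, k) (F k i)%:R.
Proof. by apply/matrixP => i k; rewrite !mxE conjc_nat. Qed.

Lemma lat_symbol_rows (E lam : R) (x y : C) :
  lat_symbol (hexM0 lam) hexM1 hexM2 E%:C x y =
  mx_of_rows 8 (hex_rows E%:C lam%:C x x^-1 y y^-1).
Proof.
rewrite /lat_symbol /symbol !adj_natmx.
have e1 : (lam * 1)%:C = lam%:C :> C by rewrite mulr1.
have e2 : (lam * -1)%:C = - lam%:C :> C by rewrite mulrN1 rmorphN.
have e3 : (lam * 2)%:C = 2 * lam%:C :> C by rewrite mulrC rmorphM rmorph_nat.
have e4 : (lam * -2)%:C = - (2 * lam%:C) :> C by rewrite mulrN rmorphN /= e3.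
apply/matrixP => i k; rewrite !mxE -val_eqE -[val i == val k]/(eqn i k) /cell_values /hex_rows.
move: (x^-1) (y^-1) => x' y'.
case: i => [[|[|[|[|[|[|[|[|i]]]]]]]] hi] //;
   case: k => [[|[|[|[|[|[|[|[|k]]]]]]]] hk] //;
lazy [nth odflt oapp eqn nat_of_ord nat_of_bool row_hop col_hop];
rewrite ?(e1, e2, e3, e4) ?mulr1n ?mulr0n ?mulr1 ?mulr0 ?addr0 ?sub0r ?oppr0 ?add0r ?subr0 //;
by rewrite addr0.
Qed.

Variable Q : hex_vertex R -> R.
Hypothesis Qper : periodic22 Q.
Hypothesis Q1 : value_at Q 0 1.
Hypothesis Q2 : value_at Q a1 (-1).
Hypothesis Q3 : value_at Q bplus 1.
Hypothesis Q4 : value_at Q (a1 + bplus) 2.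
Hypothesis Q5 : value_at Q bminus (-2).
Hypothesis Q6 : value_at Q (a1 + bminus) (-1).
Hypothesis Q7 : value_at Q (bplus + bminus) 1.
Hypothesis Q8 : value_at Q (a1 + bplus + bminus) (-1).

Lemma Q_shift_plus n m s (k : int) : Q (vertex R (n + 2 * k) m s) = Q (vertex R n m s).
Proof.
have step n' : Q (vertex R (n' + 2) m s) = Q (vertex R n' m s).
  apply: Qper; left; rewrite -[LHS]/(hex_pos R (n' + 2) m s) -[val _]/(hex_pos R n' m s).
  rewrite /hex_pos mulrzDr -[_ *~ 2]pmulrn; move: (bplus *+ 2) => t.
  by rewrite !addrA [RHS]addrAC.
elim/int_ind: k => [|k IH|k IH]; first by rewrite mulr0 addr0.
  by rewrite -IH -[RHS]step; congr (Q (vertex R _ m s)); lia.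
by rewrite -IH -[LHS]step; congr (Q (vertex R _ m s)); lia.
Qed.

Lemma Q_shift_minus n m s (k : int) : Q (vertex R n (m + 2 * k) s) = Q (vertex R n m s).
Proof.
have step m' : Q (vertex R n (m' + 2) s) = Q (vertex R n m' s).
  apply: Qper; right; rewrite -[LHS]/(hex_pos R n (m' + 2) s) -[val _]/(hex_pos R n m' s).
  rewrite /hex_pos mulrzDr -[_ *~ 2]pmulrn; move: (bminus *+ 2) => t.
  by rewrite !addrA.
elim/int_ind: k => [|k IH|k IH]; first by rewrite mulr0 addr0.
  by rewrite -IH -[RHS]step; congr (Q (vertex R n _ s)); lia.
by rewrite -IH -[LHS]step; congr (Q (vertex R n _ s)); lia.
Qed.

Lemma Q_site j l i : Q (site R j l i) = nth 0 cell_values i.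
Proof.
rewrite /site addrC Q_shift_plus [2 * l + _]addrC Q_shift_minus.
have posE (n m : int) s : val (vertex R n m s) = hex_pos R n m s by [].
case: i => [[|[|[|[|[|[|[|[|i]]]]]]]] hi] // /=.
- by apply: Q1; rewrite posE /hex_pos !mulr0z !addr0.
- by apply: Q3; rewrite posE /hex_pos mulr0z mulr1z addr0 add0r.
- by apply: Q5; rewrite posE /hex_pos mulr0z mulr1z !add0r.
- by apply: Q7; rewrite posE /hex_pos !mulr1z add0r.
- by apply: Q2; rewrite posE /hex_pos !mulr0z !addr0.
- by apply: Q4; rewrite posE /hex_pos mulr0z mulr1z addr0.
- by apply: Q6; rewrite posE /hex_pos mulr0z mulr1z addr0.
- by apply: Q8; rewrite posE /hex_pos !mulr1z.
Qed.

Lemma hex_lat lam f j l :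
  to_field (@site R) (hex_schrodinger (fun u => lam * Q u) f) j l =
  lat (hexM0 lam) hexM1 hexM2 0 (to_field (@site R) f) j l.
Proof.
apply/colP => i; rewrite mxE /hex_schrodinger Q_site /hexM0; move: cell_values => cv.
pose g (j l : int) (k : nat) := f (vertex R (2 * j + (odd k)%:Z) (2 * l + (odd k./2)%:Z) (4 <= k)%N).
have fg j' l' k : f (site R j' l' k) = g j' l' k by [].
have E (n m : int) s j' l' k : n = 2 * j' + (odd k)%:Z -> m = 2 * l' + (odd k./2)%:Z ->
  s = (4 <= k)%N -> f (vertex R n m s) = g j' l' k by move=> -> -> ->.
rewrite /lat /stencil raddf0 subr0 !adj_natmx !mxE !big_ord_recl !big_ord0.
rewrite !mxE !fg /site !lift0.
pose q k := (lam * nth 0 cv k)%:C.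
have qE k : (lam * nth 0 cv k)%:C = q k by [].
rewrite !qE; clearbody q.
have ord00 n : nat_of_ord (@ord0 n) = 0%N by [].
rewrite !ord00.
case: i => [[|[|[|[|[|[|[|[|i]]]]]]]] hi] //.
all: lazy [nth odflt oapp nat_of_ord row_hop col_hop].
- transitivity (g j l 4%N + g (j - 1) l 5%N + g j (l - 1) 6%N + q 0%N * g j l 0%N); last by ring.
  by rewrite laplacian_false; congr (_ + _ + _ + _); apply: E => /=; lia.
- transitivity (g j l 5%N + g j l 4%N + g j (l - 1) 7%N + q 1%N * g j l 1%N); last by ring.
  by rewrite laplacian_false; congr (_ + _ + _ + _); apply: E => /=; lia.
- transitivity (g j l 6%N + g (j - 1) l 7%N + g j l 4%N + q 2%N * g j l 2%N); last by ring.
  by rewrite laplacian_false; congr (_ + _ + _ + _); apply: E => /=; lia.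
- transitivity (g j l 7%N + g j l 6%N + g j l 5%N + q 3%N * g j l 3%N); last by ring.
  by rewrite laplacian_false; congr (_ + _ + _ + _); apply: E => /=; lia.
- transitivity (g j l 0%N + g j l 1%N + g j l 2%N + q 4%N * g j l 4%N); last by ring.
  by rewrite laplacian_true; congr (_ + _ + _ + _); apply: E => /=; lia.
- transitivity (g j l 1%N + g (j + 1) l 0%N + g j l 3%N + q 5%N * g j l 5%N); last by ring.
  by rewrite laplacian_true; congr (_ + _ + _ + _); apply: E => /=; lia.
- transitivity (g j l 2%N + g j l 3%N + g j (l + 1) 0%N + q 6%N * g j l 6%N); last by ring.
  by rewrite laplacian_true; congr (_ + _ + _ + _); apply: E => /=; lia.
- transitivity (g j l 3%N + g (j + 1) l 2%N + g j (l + 1) 1%N + q 7%N * g j l 7%N); last by ring.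
  by rewrite laplacian_true; congr (_ + _ + _ + _); apply: E => /=; lia.
Qed.

End HexOperator.

(** * The spectrum *)

Section DeterminantBounds.
Variable R : rcfType.
Local Notation C := R[i].

Lemma abs2_sum_fin (I : finType) (F : I -> C) :
  abs2 (\sum_i F i) <= #|I|%:R * \sum_i abs2 (F i).
Proof.
rewrite (reindex _ (onW_bij _ (enum_val_bij I))) [X in _ * X](reindex _ (onW_bij _ (enum_val_bij I))).
exact: abs2_sum.
Qed.

(** Leibniz expansion and Cauchy-Schwarz over the permutations. *)
Lemma abs2_det_le n (A : 'M[C]_n) (L : R) : (forall i j, abs2 (A i j) <= L) ->
  abs2 (\det A) <= #|{perm 'I_n}|%:R * (#|{perm 'I_n}|%:R * L ^+ n).
Proof.
move=> hA; apply: le_trans (abs2_sum_fin _) _; apply: ler_wpM2l => //.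
apply: (@le_trans _ _ (\sum_(s : {perm 'I_n}) L ^+ n)).
  apply: ler_sum => s _; rewrite abs2M abs2X abs2N abs21 expr1n mul1r.
  rewrite (big_morph _ (@abs2M R) (abs21 R)) -[X in L ^+ X]card_ord -prodr_const.
  by apply: ler_prod => i _; rewrite abs2_ge0 hA.
by rewrite sumr_const mulr_natl.
Qed.

(** From det(A) v = adj(A) (A v) with adj(A) bounded entrywise. As c depends only on n, L and delta,
    it is uniform over the torus without a compactness argument. *)
Lemma det_bounded_below n (L delta : R) : 0 <= L -> 0 < delta ->
  exists2 c : R, 0 < c & forall A : 'M[C]_n,
    (forall i j, abs2 (A i j) <= L) -> delta <= abs2 (\det A) ->
    forall v, c * vnorm2 v <= vnorm2 (A *m v).
Proof.
move=> L0 d0; pose P : R := #|{perm 'I_n.-1}|%:R.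
pose B := P * (P * L ^+ n.-1); pose K : R := n%:R * (n%:R * (n%:R * B)).
have P0 : 0 <= P by rewrite /P.
have B0 : 0 <= B by apply: mulr_ge0 => //; apply: mulr_ge0 => //; exact: exprn_ge0.
have K0 : 0 <= K by do 3 (apply: mulr_ge0 => //).
exists (delta / (K + 1)); first by apply: divr_gt0 => //; lra.
move=> A hA hd v.
have adjE : \det A *: v = \adj A *m (A *m v) by rewrite mulmxA mul_adj_mx mul_scalar_mx.
have h1 : delta * vnorm2 v <= K * vnorm2 (A *m v).
  apply: (@le_trans _ _ (abs2 (\det A) * vnorm2 v)); first by apply: ler_wpM2r; rewrite ?vnorm2_ge0.
  rewrite -vnorm2Z adjE; apply: le_trans (vnorm2_mulmx _ _) _.
  apply: ler_wpM2r; first exact: vnorm2_ge0.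
  apply: ler_wpM2l => //.
  apply: (@le_trans _ _ (\sum_(i < n) \sum_(j < n) B)).
    apply: ler_sum => i _; apply: ler_sum => j _; rewrite mxE /cofactor abs2M abs2X abs2N abs21 expr1n mul1r.
    by apply: abs2_det_le => i' j'; rewrite !mxE.
  by rewrite !sumr_const card_ord !mulr_natl.
rewrite mulrAC ler_pdivrMr; last lra.
apply: le_trans h1 _; rewrite mulrC; apply: ler_wpM2l; [exact: vnorm2_ge0 | lra].
Qed.

End DeterminantBounds.

Section SpectrumCharacterization.
Variable R : realType.
Local Notation C := R[i].

Local Notation hsym lam := (lat_symbol (hexM0 lam) (hexM1 R) (hexM2 R)).

Definition band (e m : R) := lower_band e m \/ upper_band e m.

Lemma det_disp (E lam x1 x2 y1 y2 : R) :
  x1 ^+ 2 + x2 ^+ 2 = 1 -> y1 ^+ 2 + y2 ^+ 2 = 1 ->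
  \det (hsym lam E%:C (x1 +i* x2) (y1 +i* y2)) =
  (disp (E ^+ 2) (lam ^+ 2) (x1 + y1 + (x1 * y1 + x2 * y2))
        ((x2 - y2 - (x2 * y1 - x1 * y2)) ^+ 2))%:C.
Proof.
move=> hx hy.
have ux : abs2 (x1 +i* x2) = 1 by [].
have uy : abs2 (y1 +i* y2) = 1 by [].
have nz (z : C) : abs2 z = 1 -> z != 0 by move=> h; rewrite -abs2_eq0 h oner_eq0.
rewrite lat_symbol_rows det_hex_rows ?mulfV ?nz //.
rewrite -(unit_conjE ux) -(unit_conjE uy).
set J := (x2 - y2 - (x2 * y1 - x1 * y2)); set S := x1 + y1 + _.
have -> : x1 +i* x2 - conjc (x1 +i* x2) - (y1 +i* y2 - conjc (y1 +i* y2)) -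
    ((x1 +i* x2) * conjc (y1 +i* y2) - conjc (x1 +i* x2) * (y1 +i* y2)) = 0 +i* (2 * J).
  by apply/eqP; rewrite eq_complex /J /=; apply/andP; split; apply/eqP; ring.
have -> : x1 +i* x2 + conjc (x1 +i* x2) + (y1 +i* y2) + conjc (y1 +i* y2) +
    (x1 +i* x2) * conjc (y1 +i* y2) + conjc (x1 +i* x2) * (y1 +i* y2) = (2 * S)%:C.
  by apply/eqP; rewrite eq_complex /S /=; apply/andP; split; apply/eqP; ring.
have -> : (0 +i* (2 * J)) ^+ 2 = (- 4 * J ^+ 2)%:C :> C.
  by apply/eqP; rewrite expr2 eq_complex /=; apply/andP; split; apply/eqP; ring.
rewrite /disp /kap /cst; clearbody J S; ring.
Qed.

Lemma symbol_entry_bound lam (z x y : C) i j : abs2 x = 1 -> abs2 y = 1 ->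
  abs2 (hsym lam z x y i j) <=
  lat_bound (hexM0 lam) (hexM1 R) (hexM2 R) z.
Proof.
move=> hx hy; set A := lat_symbol _ _ _ _ _ _; pose v : 'cV[C]_8 := delta_mx j 0.
have -> : A i j = (A *m v) i 0.
  rewrite [RHS]mxE (bigD1 j) //= [v j 0]mxE !eqxx mulr1 big1 ?addr0 // => k kj.
  by rewrite [v k 0]mxE (negbTE kj) mulr0.
apply: le_trans (vnorm2_coord _ _) _; apply: le_trans (lat_symbol_bound _ _ _ _ _ hx hy) _.
rewrite ler_piMr ?lat_bound_ge0 // /vnorm2 (bigD1 j) //= mxE !eqxx abs21 big1 ?addr0 // => k kj.
by rewrite mxE (negbTE kj) abs20.
Qed.

Lemma lat_symbol_sub d (M0 M1 M2 : 'M[C]_d) (w z x y : C) :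
  lat_symbol M0 M1 M2 (w + z) x y = lat_symbol M0 M1 M2 w x y - z%:M.
Proof.
rewrite /lat_symbol /symbol raddfD opprD addrA.
move: (M0 - w%:M) (x *: _) (x^-1 *: _) (y *: _) (y^-1 *: _) => A B D E F.
by rewrite [RHS]addrC !addrA; do 4 congr (_ + _); rewrite addrC.
Qed.

(* Off the real axis [|(H - z) v|^2 = |(H - Re z) v|^2 + (Im z)^2 |v|^2]. *)
Lemma symbol_nonreal lam (a b : R) (x y : C) v : abs2 x = 1 -> abs2 y = 1 ->
  b ^+ 2 * vnorm2 v <= vnorm2 (hsym lam (a +i* b) x y *m v).
Proof.
move=> hx hy; have -> : a +i* b = a%:C + b%:C * 'i%C.
  by apply/eqP; rewrite eq_complex /=; apply/andP; split; apply/eqP; ring.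
rewrite lat_symbol_sub mulmxBl mul_scalar_mx -scalerA; set L := lat_symbol _ _ _ _ _ _.
have Lh : adjmx L = L.
  by rewrite /L adjmx_lat_symbol ?conjc_real //; exact: hexM0_herm.
rewrite vnorm2_subZ -scalemxAr mxE adjmxM Lh.
set r := (_ *m v) 0 0.
have rr : conjc r = r.
  have -> : conjc r = adjmx (adjmx v *m L *m v) 0 0 by rewrite [RHS]mxE [_^T _ _]mxE.
  by rewrite !adjmxM adjmxK Lh mulmxA.
have -> : complex.Re ('i%C * r) = 0.
  by case: r rr => p q [] /= h; lra.
rewrite mulr0 subr0 vnorm2Z (_ : abs2 'i%C = 1) ?mul1r; last by rewrite /abs2 /= expr0n add0r expr1n.
by rewrite lerDr vnorm2_ge0.
Qed.

Variables (Q : hex_vertex R -> R).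
Hypothesis Qper : periodic22 Q.
Hypothesis Q1 : value_at Q 0 1.
Hypothesis Q2 : value_at Q a1 (-1).
Hypothesis Q3 : value_at Q bplus 1.
Hypothesis Q4 : value_at Q (a1 + bplus) 2.
Hypothesis Q5 : value_at Q bminus (-2).
Hypothesis Q6 : value_at Q (a1 + bminus) (-1).
Hypothesis Q7 : value_at Q (bplus + bminus) 1.
Hypothesis Q8 : value_at Q (a1 + bplus + bminus) (-1).

Lemma sigmaP (lam : R) (z : C) : 0 < lam ^+ 2 <= (1 / 100) ^+ 2 ->
  sigma (fun u => lam * Q u) z <-> exists2 E : R, z = E%:C & band (E ^+ 2) (lam ^+ 2).
Proof.
move=> /andP[m0 m1]; have [coord coordE] := choice (@site_surj R).
pose row_of u := (coord u).1.1; pose col_of u := (coord u).1.2; pose comp_of u := (coord u).2.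
have siteK u : site R (row_of u) (col_of u) (comp_of u) = u by exact: coordE.
have site_coord j l i : coord (site R j l i) = (j, l, i).
  have := coordE (site R j l i); case: (coord _) => -[j' l'] i' /= e.
  by have [-> -> ->] := site_inj e.
have rK j l i : row_of (site R j l i) = j by rewrite /row_of site_coord.
have cK j l i : col_of (site R j l i) = l by rewrite /col_of site_coord.
have kK j l i : comp_of (site R j l i) = i by rewrite /comp_of site_coord.
have lat_eq f j l := hex_lat Qper Q1 Q2 Q3 Q4 Q5 Q6 Q7 Q8 lam f j l.
have herm := hexM0_herm lam.
have resolvent c : 0 < c -> (forall x y, abs2 x = 1 -> abs2 y = 1 ->
    forall v, c * vnorm2 v <= vnorm2 (hsym lam z x y *m v)) ->
    ~ sigma (fun u => lam * Q u) z.
  move=> c0 hc; apply; exact: (in_resolvent siteK rK cK kK herm lat_eq c0 hc).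
split=> [hz|[E -> hE]]; last first.
  have E20 := sqr_ge0 E; have [c hc dc] := disp_zero m0 m1 E20 hE.
  pose s := Num.sqrt (1 - c ^+ 2).
  have s2 : s ^+ 2 = 1 - c ^+ 2.
    by rewrite sqr_sqrtr // subr_ge0; case/andP: hc => h1 h2; nra.
  have hx : c ^+ 2 + s ^+ 2 = 1 by rewrite s2; ring.
  have hy : c ^+ 2 + (- s) ^+ 2 = 1 by rewrite sqrrN.
  have d0 : \det (hsym lam E%:C (c +i* s) (c +i* - s)) = 0.
    rewrite det_disp //; apply/eqP; rewrite eq_complex /= eqxx andbT -dc; apply/eqP.
    have -> : c + c + (c * c + s * - s) = 2 * c + c ^+ 2 - s ^+ 2 by ring.
    have -> : (s - - s - (s * c - c * - s)) ^+ 2 = 4 * s ^+ 2 * (1 - c) ^+ 2 by ring.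
    by rewrite s2; congr disp; ring.
  (* [det0P] yields a row null vector, hence the transposes. *)
  have /det0P[w w0 hw] : \det (hsym lam E%:C (c +i* s) (c +i* - s))^T == 0 by rewrite det_tr d0.
  apply: (in_spectrum siteK rK cK kK lat_eq (x := c +i* s) (y := c +i* - s) (v := w^T)) => //.
    by apply: contra w0 => /eqP h; rewrite -[w]trmxK h trmx0.
  by rewrite -[LHS]trmxK trmx_mul trmxK hw trmx0.
case: z resolvent hz => a b resolvent hz.
have [b0|b0] := eqVneq b 0; last first.
  exfalso; apply: (resolvent (b ^+ 2)) hz; first by rewrite exprn_even_gt0.
  by move=> x y hx hy v; exact: symbol_nonreal.
rewrite b0 in resolvent hz *; exists a => //.
have [//|nband] := pselect (band (a ^+ 2) (lam ^+ 2)); exfalso.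
have [||delta d0 hd] := disp_nonzero m0 m1 (sqr_ge0 a).
- by move=> h; apply: nband; left.
- by move=> h; apply: nband; right.
have L0 := lat_bound_ge0 (hexM0 lam) (hexM1 R) (hexM2 R) a%:C.
have [|c c0 hc] := @det_bounded_below R 8 _ (delta ^+ 2) L0; first by rewrite exprn_gt0.
apply: (resolvent c c0) hz => x y hx hy v; apply: hc.
  by move=> i j; exact: symbol_entry_bound.
case: x y hx hy => [x1 x2] [y1 y2] hx hy.
rewrite det_disp // abs2_real -[leRHS]real_normK ?num_real //.
by rewrite ler_sqr ?nnegrE ?(ltW d0) //; exact: hd.
Qed.

End SpectrumCharacterization.

(** * Components and gaps *)

Section RealSets.
Variable R : realType.
Implicit Types (W : set R).
Local Notation CT := (R[i] : numClosedFieldType).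

Lemma real_complex_continuous : continuous (fun x : R => x%:C : CT).
Proof.
move=> x; apply/cvgrPdist_lt => eps eps0.
have [e e0 ee] : exists2 e : R, 0 < e & eps = e%:C.
  exists (complex.Re eps); first by move: eps0; rewrite ltcE => /andP[].
  by rewrite RRe_real // gtr0_real.
near=> t; rewrite ee -rmorphB /= normc_def /= expr0n addr0 sqrtr_sqr ltcR.
by near: t; apply: (@cvgr_dist_lt R R R (nbhs x) _ id).
Unshelve. all: by end_near.
Qed.

Lemma Re_continuous : continuous (fun z : CT => complex.Re z : R).
Proof.
move=> z; apply/(@cvgrPdist_lt R R CT (nbhs z) (nbhs_filter z)) => e e0.
exists (e%:C : CT) => [|t]; first by rewrite /= ltcR.
rewrite /= normc_def ltcR => h; apply: le_lt_trans h.
case: z t => [a b] [c d] /=.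
by rewrite -sqrtr_sqr ler_sqrt ?addr_ge0 ?sqr_ge0 // lerDl sqr_ge0.
Qed.

Lemma connected_gap W (E a b : R) : a < E < b ->
  (forall x, a < x < b -> ~ W x) -> `]a, b[ `<=` connected_component (~` W) E.
Proof.
move=> Eab nW; apply: connected_component_max.
- by rewrite /= in_itv.
- by move=> x; rewrite /= in_itv /= => /nW.
- by apply/connected_intervalP; exact: interval_is_interval.
Qed.

Lemma gap_connected W (E p q : R) : W p -> W q -> p < E < q ->
  connected_component (~` W) E `<=` `]p, q[.
Proof.
move=> Wp Wq /andP[pE Eq] y hy.
have : connected (connected_component (~` W) E) by exact: component_connected.
move=> /connected_intervalP itv.
have nWE : (~` W) E.
  by apply: contrapT => nE; move: hy; rewrite connected_component_out.
have hE := connected_component_refl nWE.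
have sub := @connected_component_sub _ (~` W) E.
rewrite /= in_itv /= !ltNge; apply/andP; split; apply/negP => h.
  by apply: (sub p (itv _ _ hy hE p _)) Wp; rewrite h ltW.
by apply: (sub q (itv _ _ hE hy q _)) Wq; rewrite h ltW.
Qed.

Variables (W : set R) (sig : set CT).
Hypothesis sigP : forall z, sig z <-> exists2 E : R, z = E%:C & W E.
Variable cell : nat -> set R.

Let piece k : set CT := (fun x : R => x%:C : CT) @` (W `&` cell k).

Hypothesis W_cell : forall E, W E -> exists2 k, (k < 4)%N & cell k E.
Hypothesis cell_sep : forall B : set R, is_interval B -> B `<=` W ->
  forall k x y, B x -> B y -> cell k x -> cell k y.
Hypothesis cell_band : forall k, is_interval (W `&` cell k).
Hypothesis cell_ex : forall k, (k < 4)%N -> exists E, (W `&` cell k) E.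
Hypothesis cell_disj : forall k l E, (k < 4)%N -> (l < 4)%N -> cell k E -> cell l E -> k = l.

(** The real part maps a component onto an interval inside W, which cannot leave its cell;
    conversely a piece is the continuous image of an interval. *)
Lemma component_piece k E : (W `&` cell k) E -> connected_component sig (E%:C : CT) = piece k.
Proof.
move=> hE; apply/seteqP; split=> [z hz|].
  have zsig : sig z by exact: (connected_component_sub hz).
  have [y zy Wy] := (sigP z).1 zsig.
  exists y => //; split => //.
  have Cc := @component_connected _ sig (E%:C : CT).
  pose B : set R := (fun z : CT => complex.Re z : R) @` connected_component sig (E%:C : CT).
  have Bitv : is_interval B.
    apply/connected_intervalP; apply: connected_continuous_connected Cc _.
    by apply: continuous_subspaceT; exact: Re_continuous.
  have BW : B `<=` W.
    move=> _ [w hw <-]; have [t -> Wt] := (sigP w).1 (connected_component_sub hw).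
    by [].
  have Esig : sig (E%:C : CT) by apply/sigP; exists E => //; exact: hE.1.
  apply: (cell_sep Bitv BW (x := E)) hE.2.
    by exists (E%:C : CT) => //; exact: connected_component_refl.
  by exists z => //; rewrite zy.
apply: connected_component_max.
- by exists E.
- by move=> _ [x [Wx _] <-]; apply/sigP; exists x.
- apply: connected_continuous_connected.
    by apply/connected_intervalP; exact: cell_band.
  by apply: continuous_subspaceT; exact: real_complex_continuous.
Qed.

Lemma components_card : (components sig #= `I_4)%card.
Proof.
have -> : components sig = piece @` `I_4.
  apply/seteqP; split=> [_ [z hz <-]|_ [k hk <-]].
    have [E -> WE] := (sigP z).1 hz; have [k k4 kE] := W_cell WE.
    by exists k => //; rewrite (@component_piece k).
  have [E hE] := cell_ex hk; exists (E%:C : CT); last exact: component_piece.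
  by apply/sigP; exists E => //; exact: hE.1.
apply: inj_card_eq => k l /set_mem hk /set_mem hl e.
have [E hE] := cell_ex hk.
have : piece l (E%:C : CT) by rewrite -e; exists E.
case=> y [_ hy] /complexI yE; rewrite yE in hy.
exact: cell_disj hk hl hE.2 hy.
Qed.

End RealSets.

(** * Bands, cells and gap edges in the energy E *)

Section Bands.
Variable R : realType.
Implicit Types (e m E : R).

Lemma band_small m e (m0 : 0 < m) (m1 : m <= (1 / 100) ^+ 2) :
  0 <= e -> e <= m / 25 -> ~ band e m.
Proof.
move=> e0 e1 [[_ [h _]]|[h _]]; last lra.
by have := dispK_small m0 m1 e0 e1; rewrite ltNge h.
Qed.

Lemma band_middle m e (m0 : 0 < m) (m1 : m <= (1 / 100) ^+ 2) :
  1 - m / 10 < e -> e < 1 + m -> ~ band e m.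
Proof.
move=> e0 e1 [[_ [_ h]]|[h _]]; last lra.
by have := disp0_neg m0 m1 e0 e1; rewrite ltNge h.
Qed.

Lemma band_sixteenth m (m0 : 0 < m) (m1 : m <= (1 / 100) ^+ 2) : band (m / 16) m.
Proof.
left; split; [lra | split; first exact: dispK_sixteenth].
by apply: (disp0_mono m0 m1 _ _ (disp0_half m0 m1)); lra.
Qed.

Lemma band_half m (m0 : 0 < m) (m1 : m <= (1 / 100) ^+ 2) : band (1 - m / 2) m.
Proof.
left; split; [lra | split; last exact: disp0_half].
by apply: ltW; apply: (dispK_mid m0 m1); lra.
Qed.

Lemma band_edge m (m0 : 0 < m) (m1 : m <= (1 / 100) ^+ 2) : band (1 + m) m.
Proof. by right; split; rewrite ?disp0_edge. Qed.

(** The condition at zero quasimomentum passes down from e2. The Dirac condition passes up from e1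
    below 1/2, and holds automatically from 1/2 on. *)
Lemma lower_band_convex m e1 e e2 (m0 : 0 < m) (m1 : m <= (1 / 100) ^+ 2) :
  0 <= e1 -> e1 <= e -> e <= e2 ->
  lower_band e1 m -> lower_band e2 m -> lower_band e m.
Proof.
move=> h0 h1 h2 [l1 [k1 _]] [l2 [_ d2]]; split; first by apply: le_lt_trans l2.
split; last exact: disp0_mono d2.
have [h|h] := lerP (1 / 2) e; first by apply: ltW; apply: (dispK_mid m0 m1) => //; lra.
by apply: le_trans k1; apply: (dispK_mono m0 m1) => //; exact: ltW.
Qed.

Lemma upper_band_convex m e1 e e2 (m0 : 0 < m) (m1 : m <= (1 / 100) ^+ 2) :
  e1 <= e -> e <= e2 -> upper_band e1 m -> upper_band e2 m -> upper_band e m.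
Proof.
move=> h1 h2 [l1 _] [l2 d2]; have l : 1 + m <= e by exact: le_trans h1.
by split=> //; exact: disp0_upper_mono d2.
Qed.

(** Intervals cut at the gap energies -1, 0, 1. Indices above 3 repeat the last cell, which is
    harmless since only k < 4 is counted. *)
Definition cell (k : nat) (E : R) : Prop :=
  match k with 0 => E < -1 | 1 => -1 < E < 0 | 2 => 0 < E < 1 | _ => 1 < E end.

Variable m : R.
Hypotheses (m0 : 0 < m) (m1 : m <= (1 / 100) ^+ 2).

Let W : set R := [set E | band (E ^+ 2) m].

Let WN E : W (- E) = W E.
Proof. by rewrite /W /= sqrrN. Qed.

Let nW0 : ~ W 0.
Proof.
have M0 := m0; rewrite /W /= expr0n /=.
by apply: band_small => //; rewrite divr_ge0 // ltW.
Qed.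

Let nW1 : ~ W 1.
Proof. by have M0 := m0; rewrite /W /= expr1n; apply: band_middle => //; lra. Qed.

Let nWN1 : ~ W (-1).
Proof. by rewrite WN. Qed.

Lemma band_cell E : W E -> exists2 k, (k < 4)%N & cell k E.
Proof.
move=> hE.
have neq a : ~ W a -> E != a by move=> na; apply/eqP => e; apply: na; rewrite -e.
have [h|h|h] := ltgtP E (-1); [by exists 0%N | | by move: (neq _ nWN1); rewrite h eqxx].
have [h'|h'|h'] := ltgtP E 0; [by exists 1%N; rewrite //= h h' | | by move: (neq _ nW0); rewrite h' eqxx].
have [h''|h''|h''] := ltgtP E 1; [by exists 2%N; rewrite //= h' h'' | by exists 3%N | ].
by move: (neq _ nW1); rewrite h'' eqxx.
Qed.

Lemma cell_separated (B : set R) : is_interval B -> B `<=` W ->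
  forall k x y, B x -> B y -> cell k x -> cell k y.
Proof.
move=> itv BW k x y Bx By.
have sep a : ~ W a -> (x < a -> y < a) /\ (a < x -> a < y).
  move=> na; split=> h; rewrite ltNge; apply/negP => h'; apply: na; apply: BW.
    by apply: (itv x y Bx By); rewrite h' ltW.
  by apply: (itv y x By Bx); rewrite h' ltW.
have [s1 s1'] := sep _ nWN1; have [s0 s0'] := sep _ nW0; have [s2 s2'] := sep _ nW1.
case: k => [|[|[|k]]] /=; [exact: s1 | | | exact: s2'].
  by move=> /andP[/s1' -> /s0 ->].
by move=> /andP[/s0' -> /s2 ->].
Qed.

Lemma cell_disjoint k l E : (k < 4)%N -> (l < 4)%N -> cell k E -> cell l E -> k = l.
Proof.
by case: k => [|[|[|[|k]]]] // _; case: l => [|[|[|[|l]]]] // _ /= h1 h2; exfalso; lra.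
Qed.

Let cell2_interval : is_interval (W `&` cell 2).
Proof.
have M0 := m0; move=> x y [Wx /andP[x0 x1]] [Wy /andP[y0 y1]] z /andP[xz zy].
have z01 : cell 2 z by apply/andP; split; [exact: lt_le_trans xz | exact: le_lt_trans y1].
split=> //; move/andP: z01 => [z0 z1].
have low t : 0 < t -> t < 1 -> W t -> lower_band (t ^+ 2) m.
  by move=> t0 t1 [//|[h _]]; have : t ^+ 2 < 1 by [rewrite expr_lt1 // ltW]; lra.
left; apply: (lower_band_convex m0 m1 _ _ _ (low x _ _ Wx) (low y _ _ Wy)) => //.
- exact: sqr_ge0.
- by rewrite ler_sqr ?nnegrE // ltW.
- by rewrite ler_sqr ?nnegrE // ltW.
Qed.

Let cell3_interval : is_interval (W `&` cell 3).
Proof.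
have M0 := m0; move=> x y [Wx x1] [Wy y1] z /andP[xz zy].
have z1 : 1 < z by exact: lt_le_trans xz.
split=> //.
have up t : 1 < t -> W t -> upper_band (t ^+ 2) m.
  move=> t1 Wt; have t2 : 1 < t ^+ 2 by rewrite expr_gt1 // ltW // (lt_trans ltr01).
  (* A lower-band value of e above 1 would lie in the range excluded by [band_middle]. *)
  case: (Wt) => // -[h _]; exfalso; move: Wt; apply: band_middle => //; lra.
have pos t : 1 < t -> 0 <= t by move=> h; rewrite ltW // (lt_trans ltr01).
right; apply: (upper_band_convex m0 m1 _ _ (up x _ Wx) (up y _ Wy)) => //.
- by rewrite ler_sqr ?nnegrE // pos.
- by rewrite ler_sqr ?nnegrE // pos.
Qed.

Lemma band_cell_interval k : is_interval (W `&` cell k).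
Proof.
(* W is symmetric under negation, so cells 0 and 1 reduce to cells 3 and 2. *)
have flip k' : (forall t, cell k t -> cell k' (- t)) -> (forall t, cell k' t -> cell k (- t)) ->
    is_interval (W `&` cell k') -> is_interval (W `&` cell k).
  move=> f g itv x y [Wx cx] [Wy cy] z /andP[xz zy].
  have Wx' : W (- x) by rewrite WN.
  have Wy' : W (- y) by rewrite WN.
  have [|Wz cz] := itv (- y) (- x) (conj Wy' (f _ cy)) (conj Wx' (f _ cx)) (- z).
    by rewrite !lerN2 zy xz.
  by rewrite -[z]opprK; split; [rewrite WN | exact: g].
case: k flip => [|[|[|k]]] flip.
- by apply: (flip 3%N) => // t /=; lra.
- by apply: (flip 2%N) => // t /= /andP[? ?]; apply/andP; split; lra.
- exact: cell2_interval.
- exact: cell3_interval.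
Qed.

Lemma band_cell_nonempty k : (k < 4)%N -> exists E, (W `&` cell k) E.
Proof.
have M0 := m0; have M1 := m1.
have inW e : 0 <= e -> band e m -> W (Num.sqrt e) by move=> e0; rewrite /W /= sqr_sqrtr.
have h2 : W (Num.sqrt (m / 16)) /\ 0 < Num.sqrt (m / 16) < 1.
  split; first by apply: inW; [rewrite divr_ge0 // ltW | exact: band_sixteenth].
  by apply/andP; split; [rewrite sqrtr_gt0 | rewrite -[ltRHS]sqrtr1 ltr_sqrt]; lra.
have h3 : W (Num.sqrt (1 + m)) /\ 1 < Num.sqrt (1 + m).
  split; first by apply: inW; [lra | exact: band_edge].
  by rewrite -[ltLHS]sqrtr1 ltr_sqrt; lra.
case: k => [|[|[|[|k]]]] // _.
- by exists (- Num.sqrt (1 + m)); split; [rewrite WN; exact: h3.1 | rewrite /= ltrN2; exact: h3.2].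
- exists (- Num.sqrt (m / 16)); split; first by rewrite WN; exact: h2.1.
  by rewrite /= ltrN2 oppr_lt0 andbC; exact: h2.2.
- by exists (Num.sqrt (m / 16)).
- by exists (Num.sqrt (1 + m)).
Qed.

(** In terms of e = E^2, the values 1 - m/2 and 1 + m are in the bands, with roots within m/2 of 1,
    while |E - 1| < m/20 keeps e in (1 - m/10, 1 + m). *)
Lemma gap_one (E : R) : E = 1 \/ E = -1 ->
  `]E - m / 20, E + m / 20[ `<=` connected_component (~` W) E /\
  connected_component (~` W) E `<=` `]E - m / 2, E + m / 2[.
Proof.
have M0 := m0; have M1 := m1.
have p2 : 0 <= 1 - m / 2 by lra.
have q2 : 0 <= 1 + m by lra.
pose p := Num.sqrt (1 - m / 2); pose q := Num.sqrt (1 + m).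
have Wp : W p by rewrite /W /= sqr_sqrtr //; exact: band_half.
have Wq : W q by rewrite /W /= sqr_sqrtr //; exact: band_edge.
have p1 : 1 - m / 2 <= p < 1.
  have p0 : 0 <= p by exact: sqrtr_ge0.
  have pp : p ^+ 2 = 1 - m / 2 by exact: sqr_sqrtr.
  by apply/andP; split; nra.
have q1 : 1 < q <= 1 + m / 2.
  have q0 : 0 <= q by exact: sqrtr_ge0.
  have qq : q ^+ 2 = 1 + m by exact: sqr_sqrtr.
  by apply/andP; split; nra.
move/andP: p1 => [p1 p1']; move/andP: q1 => [q1 q1'].
have mid x : 1 - m / 20 < x < 1 + m / 20 -> ~ W x.
  by move=> /andP[h1 h2]; apply: band_middle => //; nra.
case=> ->; split.
- by apply: connected_gap mid; apply/andP; split; lra.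
- have : connected_component (~` W) 1 `<=` `]p, q[.
    by apply: gap_connected => //; rewrite p1' q1.
  by move/subset_trans; apply => x; rewrite /= !in_itv /= => /andP[h1 h2]; apply/andP; split; lra.
- apply: connected_gap; first by apply/andP; split; lra.
  by move=> x /andP[h1 h2]; rewrite -WN; apply: mid; apply/andP; split; lra.
- have : connected_component (~` W) (-1) `<=` `]- q, - p[.
    by apply: gap_connected; rewrite ?WN // !ltrN2 p1' q1.
  by move/subset_trans; apply => x; rewrite /= !in_itv /= => /andP[h1 h2]; apply/andP; split; lra.
Qed.

(** The squares of a/5 and a/4 are m/25 and m/16, the two thresholds on e. *)
Lemma gap_zero (a : R) : 0 < a -> a ^+ 2 = m ->
  `]- (a / 5), a / 5[ `<=` connected_component (~` W) 0 /\
  connected_component (~` W) 0 `<=` `]- (a / 4), a / 4[.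
Proof.
move=> a0 am; have M0 := m0; split.
  apply: connected_gap; first by apply/andP; split; lra.
  move=> x /andP[h1 h2]; apply: band_small => //; first exact: sqr_ge0.
  by rewrite -am; nra.
have Wa : W (a / 4).
  rewrite /W /= (_ : (a / 4) ^+ 2 = m / 16); first exact: band_sixteenth.
  by rewrite -am; field.
by apply: gap_connected; rewrite ?WN //; apply/andP; split; lra.
Qed.

End Bands.

Local Close Scope complex_scope.

Theorem theorem4p2 (R : realType) (Q : hex_vertex R -> R)
    (Qper : periodic22 Q)
    (Q1 : value_at Q 0 1)
    (Q2 : value_at Q a1 (-1))
    (Q3 : value_at Q bplus 1)
    (Q4 : value_at Q (a1 + bplus) 2)
    (Q5 : value_at Q bminus (-2))
    (Q6 : value_at Q (a1 + bminus) (-1))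
    (Q7 : value_at Q (bplus + bminus) 1)
    (Q8 : value_at Q (a1 + bplus + bminus) (-1)) :
  exists2 lambda0 : R, 0 < lambda0 &
    forall lambda : R, 0 < `|lambda| < lambda0 ->
      let lQ := fun u => lambda * Q u in
      [/\ (components (sigma lQ) #= `I_4)%card,
          (forall E : R, E = 1 \/ E = -1 ->
             `]E - lambda ^+ 2 / 20, E + lambda ^+ 2 / 20[ `<=` gap lQ E /\
             gap lQ E `<=` `]E - lambda ^+ 2 / 2, E + lambda ^+ 2 / 2[),
          `]- (`|lambda| / 5), `|lambda| / 5[ `<=` gap lQ 0 &
          gap lQ 0 `<=` `]- (`|lambda| / 4), `|lambda| / 4[].
Proof.
(* A convenient threshold: m = lambda^2 is then at most 10^-4, which makes the higher-order terms
   negligible in the sign estimates. *)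
exists (1 / 100); first by lra.
move=> lambda /andP[l0 l1] lQ.
have lm : `|lambda| ^+ 2 = lambda ^+ 2 by rewrite real_normK ?num_real.
have m0 : 0 < lambda ^+ 2 by rewrite -lm exprn_gt0.
have m1 : lambda ^+ 2 <= (1 / 100) ^+ 2.
  by rewrite -lm ler_sqr ?nnegrE // ?ltW // divr_ge0.
have m01 : 0 < lambda ^+ 2 <= (1 / 100) ^+ 2 by rewrite m0 m1.
have sigE z := sigmaP Qper Q1 Q2 Q3 Q4 Q5 Q6 Q7 Q8 z m01.
have gapE E : gap lQ E = connected_component (~` [set x : R | band (x ^+ 2) (lambda ^+ 2)]) E.
  rewrite /gap; congr (connected_component (~` _) E); apply/seteqP; split=> x /=.
    by move=> /sigE[y /complexI ->].
  by move=> hx; apply/sigE; exists x.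
have [g1 g2] := gap_zero m0 m1 l0 lm.
split; rewrite ?gapE //; last by move=> E hE; rewrite gapE; exact: gap_one.
apply: (components_card sigE (cell := @cell R)).
- exact: band_cell.
- exact: cell_separated.
- exact: band_cell_interval.
- exact: band_cell_nonempty.
- exact: cell_disjoint.
Qed.
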